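(* Let $\omega$ be a non-principal ultrafilter on $\mathbb N$ and let $\big(\{(X_i,d_i,\mathfrak m_i,p_i)\}_{i\in\mathbb N},\{P_{ij}\}_{i\le j}\big)$ be an inverse system of pointed Polish metric measure spaces. Then $\big((X_i,d_i,\mathfrak m_i,p_i)\big)$ is uniformly boundedly finite, i.e. $\sup_{i}\mathfrak m_i(B(p_i,R))<+\infty$ for every $R>0$, so that the ultralimit $(X_\omega,d_\omega,\mathfrak m_\omega,p_\omega)=\lim_{i\to\omega}(X_i,d_i,\mathfrak m_i,p_i)$ exists. Define $$X:=\hat X\cap{\rm spt}(\mathfrak m_\omega),\qquad \hat X:=\Big\{[[x_i]]\in X_\omega\ \Big|\ P_{ij}(x_j)=x_i\in{\rm spt}(\mathfrak m_i)\text{ for all }i\le j\Big\},$$ and $d_X:=d_\omega|_{X\times X}$, $\mathfrak m_X:=\mathfrak m_\omega|_{\mathscr B(X)}$, $p_X:=p_\omega$, where $\mathscr B(X)$ is the Borel $\sigma$-algebra of $X$. Then $(X,d_X,\mathfrak m_X)$ is a Polish metric measure space. Moreover, the inverse system admits an inverse limit (in the category of pointed Polish metric measure spaces) if and only if $p_X\in{\rm spt}(\mathfrak m_X)$. In this case, the inverse limit coincides with $(X,d_X,\mathfrak m_X,p_X)$, the natural projection maps $P_i\colon X\to X_i$ being given by $P_i([[x_k]]):=x_i$ for every $[[x_k]]\in X$.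
   Context: In this statement, a pointed Polish metric measure space $(X,d,\mathfrak m,p)$ is a complete separable metric space with a Borel measure $\mathfrak m$ finite on balls and a point $p\in{\rm spt}(\mathfrak m)$, where ${\rm spt}(\mathfrak m):=\{x:\mathfrak m(B(x,r))>0\ \forall r>0\}$ and $B(x,r)$ is the open ball; a Polish metric measure space is the same without a chosen point. A morphism $\varphi\colon(X,d_X,\mathfrak m_X,p_X)\to(Y,d_Y,\mathfrak m_Y,p_Y)$ is a Borel map $\varphi\colon X\to Y$ with $\varphi(p_X)=p_Y$, with $\varphi|_{{\rm spt}(\mathfrak m_X)}$ $1$-Lipschitz, and with $\varphi_*\mathfrak m_X\le\mathfrak m_Y$. The isomorphisms are the morphisms $\varphi$ such that $\varphi|_{{\rm spt}(\mathfrak m_X)}$ is an isometry and $\varphi_*\mathfrak m_X=\mathfrak m_Y$. Inverse system: morphisms $P_{ij}\colon X_j\to X_i$ ($i\le j$) with $P_{ii}={\rm id}_{X_i}$ and $P_{ik}=P_{ij}\circ P_{jk}$ for $i\le j\le k$. A couple $(Y,\{Q_i\})$, with $Y$ a pointed Polish metric measure space and $Q_i\colon Y\to X_i$ morphisms, projects on the inverse system if $Q_i=P_{ij}\circ Q_j$ for $i\le j$. An inverse limit is a couple $(X,\{P_i\})$ that projects on the system and such that for every $(Y,\{Q_i\})$ projecting on it there is a unique morphism $\Phi\colon Y\to X$ with $Q_i=P_i\circ\Phi$ for all $i$. Whenever it exists, the inverse limit is determined up to unique isomorphism. In the definition of $\hat X$ and of $P_i$: an element of $X_\omega$ belongs to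 $\hat X$ iff it admits a representative $(x_i)_{i\in\mathbb N}$ with $x_i\in{\rm spt}(\mathfrak m_i)$ and $P_{ij}(x_j)=x_i$ for all $i\le j$, and $P_i$ is computed with such a representative. Ultralimit $(X_\omega,d_\omega,\mathfrak m_\omega,p_\omega)$. ''For $\omega$-a.e. $i$'' means for all $i$ in some element of $\omega$. For a metric space, ${\rm Ball}(\cdot)$ is the $\sigma$-algebra generated by open balls (Borel if separable). Let $\bar X_\omega$ be the set of families $(x_i)_{i\in S}$, $S\in\omega$, $x_i\in X_i$, modulo equality for $\omega$-a.e. $i$ (classes $[x_i]$); $\bar d_\omega([x_i],[y_i]):=\lim_{i\to\omega}d_i(x_i,y_i)$; $O(\bar X_\omega):=\{[x_i]:\bar d_\omega([x_i],[p_i])<+\infty\}$. $X_\omega$ is the quotient of $O(\bar X_\omega)$ by $\bar d_\omega=0$, with classes $[[x_i]]$, induced distance $d_\omega$, projection $\pi$, and $p_\omega:=[[p_i]]$. For $S\in\omega$, $A_i\in{\rm Ball}(X_i)$, $i\in S$, let $\Pi_{i\to\omega}A_i:=\{[x_i]\in\bar X_\omega:x_i\in A_i\text{ for }\omega\text{-a.e. }i\}$; $\mathcal A_O(\bar X_\omega)$ is the algebra of all sets $(\Pi_{i\to\omega}A_i)\cap O(\bar X_\omega)$, and $\bar{\mathfrak m}_\omega\big((\Pi_{i\to\omega}A_i)\cap O(\bar X_\omega)\big):=\lim_{R\to\infty}\lim_{i\to\omega}\mathfrak m_i(A_i\cap B(p_i,R))$. $N\subset O(\bar X_\omega)$ is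 null ($N\in\mathcal N_\omega$) if for every $\varepsilon>0$ there is $\bar A\in\mathcal A_O(\bar X_\omega)$ with $N\subset\bar A$, $\bar{\mathfrak m}_\omega(\bar A)<\varepsilon$. $\bar{\mathcal B}_\omega$ is the family of $A\subset O(\bar X_\omega)$ such that for every $R>0$ there is $\bar A_R\in\mathcal A_O(\bar X_\omega)$ with $(A\cap\Pi_{i\to\omega}B(p_i,R))\Delta\bar A_R\in\mathcal N_\omega$; for such $A$, $\bar{\mathfrak m}_\omega(A):=\lim_{R\to\infty}\bar{\mathfrak m}_\omega(\bar A_R)$. If for every $R>0$ the numbers $\mathfrak m_i(B(p_i,R))$ are bounded by a finite constant for $\omega$-a.e. $i$, then $\bar{\mathcal B}_\omega$ is a $\sigma$-algebra, $\bar{\mathfrak m}_\omega$ a measure on it, $\pi^{-1}(A)\in\bar{\mathcal B}_\omega$ for $A\in{\rm Ball}(X_\omega)$, and $\mathfrak m_\omega(A):=\bar{\mathfrak m}_\omega(\pi^{-1}(A))$ for $A\in{\rm Ball}(X_\omega)$. ${\rm spt}(\mathfrak m_\omega)$ is closed and separable, and every closed separable subset of $X_\omega$ lies in ${\rm Ball}(X_\omega)$.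
   Formalization: Morphisms are identified when they agree on the support of the source measure (in the inverse system, in ''projects'', in Q_i = P_i∘Φ and in uniqueness of Φ); with pointwise equality the claim fails for the constant system {p,q} with measure δ_p and identity maps. *)

(* Defs.v *)
From HB Require Import structures.
From mathcomp Require Import all_boot all_order all_algebra generic_quotient.
From mathcomp Require Import all_classical all_reals all_analysis.

Set Implicit Arguments.
Unset Strict Implicit.
Unset Printing Implicit Defensive.

Import Order.TTheory GRing.Theory Num.Theory.
Import numFieldNormedType.Exports.

Local Open Scope classical_set_scope.
Local Open Scope ring_scope.
Local Open Scope ereal_scope.
Local Open Scope quotient_scope.

(* The library's [measurableType], [completeType] and [lim] into a space require
   a distinguished point, whereas an unpointed Polish metric measure space may
   be empty.  Hence sigma-algebras are taken as set systems, measures as set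
   functions of which only the values on a given set system matter, and
   completeness is stated with an existential limit. *)

Definition measure_on (R : realType) (T : Type) (G : set (set T))
    (m : set T -> \bar R) : Prop :=
  [/\ m set0 = 0,
      forall A, G A -> 0 <= m A &
      forall F : (set T)^nat, (forall n, G (F n)) -> trivIset setT F ->
        (fun n => \sum_(0 <= i < n) m (F i)) @ \oo --> m (\bigcup_n F n)].

Definition borel (T : topologicalType) : set (set T) := <<s @open T >>.

Definition ball_algebra (R : realType) (T : metricType R) : set (set T) :=
  <<s [set A | exists (x : T) (r : R), A = ball x r] >>.

Definition spt (R : realType) (T : metricType R) (m : set T -> \bar R) : set T :=
  [set x | forall r : R, (0 < r)%R -> 0 < m (ball x r)].

Definition complete_space (T : uniformType) : Prop :=
  forall F : set_system T, ProperFilter F -> cauchy F -> exists l : T, F --> l.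

Definition separable_space (T : topologicalType) : Prop :=
  exists2 D : set T, countable D & dense D.

Definition polish_mms (R : realType) (T : metricType R)
    (m : set T -> \bar R) : Prop :=
  [/\ complete_space T,
      separable_space T,
      measure_on (@borel T) m &
      forall (x : T) (r : R), m (ball x r) < +oo].

Record pmms (R : realType) := Pmms {
  pmms_space :> metricType R ;
  pmms_measure : set pmms_space -> \bar R ;
  pmms_point : pmms_space ;
  pmms_polish : polish_mms pmms_measure ;
  pmms_point_spt : spt pmms_measure pmms_point }.

Arguments pmms_measure {R} p _.
Arguments pmms_point {R} p.

Section Category.
Variable R : realType.
Implicit Types X Y Z : pmms R.

Definition morphism X Y (phi : X -> Y) : Prop :=
  [/\ forall B, borel B -> borel (phi @^-1` B),
      phi (pmms_point X) = pmms_point Y,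
      forall x y, spt (pmms_measure X) x -> spt (pmms_measure X) y ->
        (mdist (phi x) (phi y) <= mdist x y)%R &
      forall B, borel B -> pmms_measure X (phi @^-1` B) <= pmms_measure Y B].

(* Equality of arrows of the category.  The isomorphisms of the category are
   the morphisms that restrict to an isometry of the support and preserve the
   measure; they are invertible only if two morphisms are identified when they
   agree on the support of the measure of their source (for instance, the
   inclusion of a point p in a two-point space with measure the Dirac mass at p
   is such an isomorphism). *)
Definition eq_morphism X (T : Type) (phi psi : X -> T) : Prop :=
  forall x, spt (pmms_measure X) x -> phi x = psi x.

(* [P i j : X_j -> X_i] is relevant for [i <= j] only. *)
Definition inverse_system (X : nat -> pmms R)
    (P : forall i j, X j -> X i) : Prop :=
  [/\ forall i j, (i <= j)%N -> morphism (P i j),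
      forall i, eq_morphism (P i i) id &
      forall i j k, (i <= j)%N -> (j <= k)%N ->
        eq_morphism (P i k) (P i j \o P j k)].

Definition projects_on (X : nat -> pmms R) (P : forall i j, X j -> X i)
    (Y : pmms R) (Q : forall i, Y -> X i) : Prop :=
  (forall i, morphism (Q i)) /\
  (forall i j, (i <= j)%N -> eq_morphism (Q i) (P i j \o Q j)).

Definition inverse_limit (X : nat -> pmms R) (P : forall i j, X j -> X i)
    (L : pmms R) (p : forall i, L -> X i) : Prop :=
  projects_on P p /\
  forall (Y : pmms R) (Q : forall i, Y -> X i), projects_on P Q ->
    exists Phi : Y -> L,
      [/\ morphism Phi,
          forall i, eq_morphism (Q i) (p i \o Phi) &
          forall Psi : Y -> L, morphism Psi ->
            (forall i, eq_morphism (Q i) (p i \o Psi)) -> eq_morphism Psi Phi].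

Definition uniformly_boundedly_finite (X : nat -> pmms R) : Prop :=
  forall r : R, (0 < r)%R ->
    ereal_sup (range (fun i => pmms_measure (X i) (ball (pmms_point (X i)) r)))
      < +oo.

End Category.

Definition nonprincipal (omega : set_system nat) : Prop :=
  forall n, omega <> principal_filter n.

Section UltraLim.
Context (R : realType) (omega : set_system nat) {UF : UltraFilter omega}.

Lemma ultra_cvg_nneg (f : nat -> R) : (forall i, (0 <= f i)%R) ->
  exists2 l : \bar R, 0 <= l & (f i)%:E @[i --> omega] --> l.
Proof.
move=> f0; case: (pselect (exists M : R, omega [set i | (f i <= M)%R])).
  move=> [M fM].
  have cM : compact `[0%R, M]%classic by exact: segment_compact.
  have fF : (f @ omega) `[0%R, M]%classic.
    by rewrite /fmap /=; apply: filterS fM => i /= fiM; rewrite in_itv /= f0.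
  have [l [l0M cl]] := cM _ (fmap_proper_filter f _) fF.
  have fl : f @ omega --> l.
    move=> U Ul; have [//|nU] := in_ultra_setVsetC (f @^-1` U) UF.
    by have [y [/= nUy Uy]] := cl (~` U) U nU Ul.
  exists l%:E; first by move: l0M; rewrite /= in_itv /= lee_fin => /andP[].
  by apply/cvg_EFin => //; exact: nearW.
move=> /forallNP unb; exists +oo; first exact: leey.
apply/cvgeyPgt => A; have [|nA] := in_ultra_setVsetC [set i | (f i <= A)%R] UF.
  by move=> /unb.
by apply: filterS nA => i /= /negP; rewrite -ltNge lte_fin.
Qed.

End UltraLim.

Section Ultralimit.
Context {R : realType} (omega : set_system nat) {UF : UltraFilter omega}.
Variable X : nat -> pmms R.

Local Notation basepoint := (fun i => pmms_point (X i)).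

(* Since every X_i is inhabited, a family defined on some S in omega is equal
   omega-a.e. to a family defined everywhere, so total families suffice; the
   same applies to families of sets below. *)
Definition family : Type := forall i, X i.
HB.instance Definition _ := Choice.on family.

Definition fdist (x y : family) : \bar R :=
  lim ((mdist (x i) (y i))%:E @[i --> omega]).

Definition aeq (x y : family) : bool := `[< \forall i \near omega, x i = y i >].

Let aeq_refl : reflexive aeq.
Proof. by move=> x; apply/asboolP; exact: nearW. Qed.

Let aeq_sym : symmetric aeq.
Proof.
by move=> x y; apply/idP/idP => /asboolP h; apply/asboolP; apply: filterS h.
Qed.

Let aeq_trans : transitive aeq.
Proof.
move=> y x z /asboolP xy /asboolP yz; apply/asboolP.
by apply: filterS2 xy yz => i -> ->.
Qed.

Canonical aeq_equiv := EquivRel aeq aeq_refl aeq_sym aeq_trans.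

Definition ultraproduct : Type := {eq_quot aeq}.
HB.instance Definition _ := Choice.on ultraproduct.
HB.instance Definition _ := EqQuotient.on ultraproduct.

Definition dbar (u v : ultraproduct) : \bar R := fdist (repr u) (repr v).

Definition finite_part : set ultraproduct :=
  [set u | dbar u (\pi_ultraproduct basepoint) < +oo].

Lemma fdist_cvg x y : (mdist (x i) (y i))%:E @[i --> omega] --> fdist x y.
Proof.
have [l _ xyl] := @ultra_cvg_nneg R omega UF (fun i => mdist (x i) (y i))
  (fun i => mdist_ge0 _ _).
rewrite /fdist; suff -> : lim ((mdist (x i) (y i))%:E @[i --> omega]) = l by [].
exact/cvg_lim.
Qed.

Lemma fdist_ge0 x y : 0 <= fdist x y.
Proof.
have [l l0 xyl] := @ultra_cvg_nneg R omega UF (fun i => mdist (x i) (y i))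
  (fun i => mdist_ge0 _ _).
by rewrite /fdist; suff -> : lim ((mdist (x i) (y i))%:E @[i --> omega]) = l;
  [|exact/cvg_lim].
Qed.

Lemma fdistxx x : fdist x x = 0.
Proof.
apply/cvg_lim => //; under eq_fun do rewrite mdistxx; exact: cvg_cst.
Qed.

Lemma fdist_sym x y : fdist x y = fdist y x.
Proof. by rewrite /fdist; under eq_fun do rewrite metric_sym. Qed.

Lemma fdist_triangle y x z : fdist x z <= fdist x y + fdist y z.
Proof.
have def : fdist x y +? fdist y z by rewrite ge0_adde_def ?inE ?fdist_ge0.
have cD : (mdist (x i) (y i))%:E + (mdist (y i) (z i))%:E @[i --> omega] -->
    fdist x y + fdist y z.
  by apply: (cvgeD def); exact: fdist_cvg.
apply: (lee_cvg_to (@fdist_cvg x z) cD).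
by apply: nearW => i /=; rewrite lee_fin metric_triangle.
Qed.

Lemma eq_fdist x x' y y' : (\forall i \near omega, x i = x' i) ->
  (\forall i \near omega, y i = y' i) -> fdist x y = fdist x' y'.
Proof.
move=> xx' yy'; apply/cvg_lim => //.
apply: cvg_trans (@fdist_cvg x' y'); apply: near_eq_cvg.
by apply: filterS2 xx' yy' => i -> ->.
Qed.

Lemma repr_aeq x : \forall i \near omega, repr (\pi_ultraproduct x) i = x i.
Proof. by have /eqmodP/asboolP := reprK (\pi_ultraproduct x). Qed.

Lemma dbarE x y : dbar (\pi x) (\pi y) = fdist x y.
Proof. by apply: eq_fdist; exact: repr_aeq. Qed.

Lemma dbar_fin (u v : finite_part) : dbar (val u) (val v) \is a fin_num.
Proof.
rewrite ge0_fin_numE ?fdist_ge0 //.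
apply: (le_lt_trans (fdist_triangle (repr (\pi_ultraproduct basepoint)) _ _)).
rewrite lte_add_pinfty //; first by have /set_mem := valP u.
by rewrite fdist_sym; have /set_mem := valP v.
Qed.

Definition indist (u v : finite_part) : bool := dbar (val u) (val v) == 0.

Let indist_refl : reflexive indist.
Proof. by move=> u; rewrite /indist /dbar fdistxx. Qed.

Let indist_sym : symmetric indist.
Proof. by move=> u v; rewrite /indist /dbar fdist_sym. Qed.

Let indist_trans : transitive indist.
Proof.
move=> v u w /eqP uv /eqP vw; apply/eqP/le_anti; rewrite fdist_ge0 andbT.
apply: (le_trans (fdist_triangle (repr (val v)) _ _)).
by rewrite -/(dbar _ _) -/(dbar (val v) _) uv vw adde0.
Qed.

Canonical indist_equiv :=
  EquivRel indist indist_refl indist_sym indist_trans.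

Definition ultralimit : Type := {eq_quot indist}.
HB.instance Definition _ := Choice.on ultralimit.
HB.instance Definition _ := EqQuotient.on ultralimit.

Definition ultra_proj (u : finite_part) : ultralimit := \pi u.

Definition ultra_dist (a b : ultralimit) : R :=
  fine (dbar (val (repr a)) (val (repr b))).

Let ultra_distxx a : ultra_dist a a = 0%R.
Proof. by rewrite /ultra_dist /dbar fdistxx. Qed.

Let ultra_dist_positivity a b : ultra_dist a b = 0%R -> a = b.
Proof.
move=> ab; rewrite -(reprK a) -(reprK b); apply/eqmodP.
by rewrite /= /indist -(fineK (dbar_fin _ _)) -/(ultra_dist a b) ab.
Qed.

Let ultra_dist_sym a b : ultra_dist a b = ultra_dist b a.
Proof. by rewrite /ultra_dist /dbar fdist_sym. Qed.

Let ultra_dist_triangle b a c :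
  (ultra_dist a c <= ultra_dist a b + ultra_dist b c)%R.
Proof.
rewrite -lee_fin EFinD !fineK ?dbar_fin //; exact: fdist_triangle.
Qed.

HB.instance Definition _ := isMetric.Build R ultralimit
  ultra_distxx ultra_dist_positivity ultra_dist_sym ultra_dist_triangle.

Lemma ultra_projE u v :
  mdist (ultra_proj u) (ultra_proj v) = fine (dbar (val u) (val v)).
Proof.
have h (w : finite_part) : dbar (val (repr (ultra_proj w))) (val w) = 0.
  by apply/eqP; have /eqmodP := reprK (ultra_proj w).
have le_l (w w' z : finite_part) : dbar (val w) (val w') = 0 ->
    dbar (val w) (val z) <= dbar (val w') (val z).
  move=> ww'; apply: (le_trans (fdist_triangle (repr (val w')) _ _)).
  by rewrite -/(dbar _ _) -/(dbar (val w') _) ww' add0e.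
have eq_l (w w' z : finite_part) : dbar (val w) (val w') = 0 ->
    dbar (val w) (val z) = dbar (val w') (val z).
  by move=> ww'; apply/le_anti; rewrite !le_l //; rewrite /dbar fdist_sym.
have dbar_sym (w z : finite_part) : dbar (val w) (val z) = dbar (val z) (val w).
  by rewrite /dbar fdist_sym.
have -> : mdist (ultra_proj u) (ultra_proj v) =
  fine (dbar (val (repr (ultra_proj u))) (val (repr (ultra_proj v)))) by [].
by rewrite (eq_l _ _ _ (h u)) dbar_sym (eq_l _ _ _ (h v)) dbar_sym.
Qed.

Let basepoint_finite : \pi_ultraproduct basepoint \in finite_part.
Proof. by apply/mem_set; rewrite /finite_part /= /dbar fdistxx ltry. Qed.

Definition ultra_point : ultralimit :=
  ultra_proj (exist _ (\pi_ultraproduct basepoint) basepoint_finite).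

Definition set_family : Type := forall i, set (X i).

Definition ball_family (A : set_family) : Prop := forall i, ball_algebra (A i).

(* The trace on the finite part of the ultraproduct of the family [A]. *)
Definition internal (A : set_family) : set finite_part :=
  [set u | \forall i \near omega, A i (repr (val u) i)].

(* A function of [A] that depends only on [internal A]. *)
Definition internal_measure (A : set_family) : \bar R :=
  lim (lim (pmms_measure (X i) (A i `&` ball (pmms_point (X i)) r)
    @[i --> omega]) @[r --> +oo%R]).

Definition ultra_null (N : set finite_part) : Prop :=
  forall eps : R, (0 < eps)%R -> exists A : set_family,
    [/\ ball_family A, N `<=` internal A & internal_measure A < eps%:E].

Definition approximates (B : set finite_part) (r : R) (A : set_family) : Prop :=
  ball_family A /\
  ultra_null
    ((B `&` internal (fun i => ball (pmms_point (X i)) r)) `+` internal A).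

Definition ultra_algebra : set (set finite_part) :=
  [set B | forall r : R, (0 < r)%R -> exists A, approximates B r A].

(* The choice of the approximating families does not matter. *)
Definition mbar (B : set finite_part) : \bar R :=
  lim (internal_measure (xget ((fun i => set0) : set_family) (approximates B r))
    @[r --> +oo%R]).

Definition ultra_measure (A : set ultralimit) : \bar R :=
  mbar (ultra_proj @^-1` A).

Definition ultralimit_exists : Prop :=
  [/\ sigma_algebra setT ultra_algebra,
      measure_on ultra_algebra mbar &
      forall A, ball_algebra A -> ultra_algebra (ultra_proj @^-1` A)].

End Ultralimit.

Arguments fdist {R} omega {X} x y.
Arguments ultraproduct {R} omega {UF} X.
Arguments finite_part {R} omega {UF} X.
Arguments ultralimit {R} omega {UF} X.
Arguments ultra_point {R} omega {UF} X.
Arguments internal {R} omega {UF X} A _.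
Arguments internal_measure {R} omega {X} A.
Arguments ultra_algebra {R} omega {UF} X _.
Arguments ultra_measure {R} omega {UF} X A.
Arguments ultralimit_exists {R} omega {UF} X.

Section SubMetric.
Context (R : realType) (T : metricType R) (A : set T).

Let sub_dist (x y : A) : R := mdist (set_val x) (set_val y).

Let sub_dist_ge0 x y : (0 <= sub_dist x y)%R.
Proof. exact: mdist_ge0. Qed.

Let sub_dist_positivity x y : sub_dist x y = 0%R -> x = y.
Proof. by move=> /mdist_positivity /val_inj. Qed.

Let sub_ballE (x : A) d : ball x d = [set y | (sub_dist x y < d)%R].
Proof.
by rewrite (_ : ball x d = set_val @^-1` ball (set_val x) d) // ballEmdist.
Qed.

HB.instance Definition _ := @PseudoMetric_isMetric.Build R A
  sub_dist sub_dist_ge0 sub_dist_positivity sub_ballE.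

End SubMetric.

Section InverseLimitSpace.
Context {R : realType} (omega : set_system nat) {UF : UltraFilter omega}.
Variables (X : nat -> pmms R) (P : forall i j, X j -> X i).
Arguments P : clear implicits.

Definition thread (x : family X) : Prop :=
  (forall i, spt (pmms_measure (X i)) (x i)) /\
  (forall i j, (i <= j)%N -> P i j (x j) = x i).

Definition represents (a : ultralimit omega X) (x : family X) : Prop :=
  exists2 u : finite_part omega X,
    val u = \pi_(ultraproduct omega X) x & ultra_proj u = a.

Definition hat_space : set (ultralimit omega X) :=
  [set a | exists2 x, represents a x & thread x].

Definition limit_space : set (ultralimit omega X) :=
  hat_space `&` spt (ultra_measure omega X).

Definition limit_measure (A : set limit_space) : \bar R :=
  ultra_measure omega X (set_val @` A).

(* A point of [limit_space] has a unique representative that is a thread, as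
   soon as [omega] is nonprincipal. *)
Definition limit_proj (i : nat) (a : limit_space) : X i :=
  xget ((fun k => pmms_point (X k)) : family X)
    [set x | represents (set_val a) x /\ thread x] i.

End InverseLimitSpace.

Arguments limit_space {R} omega {UF X} P _.
Arguments limit_measure {R} omega {UF X} P A.
Arguments limit_proj {R} omega {UF X} P i a.

(* Main.v *)
(** The thread coordinates of two points of the hat space are at nondecreasing
    distances, so the ultralimit distance between two threads is the supremum of
    the distances of their coordinates.  This makes threads unique, the
    projections 1-Lipschitz, and the limit space complete.  It is separable
    because it lies in the support of a measure that is finite on balls.  The
    ultralimit measure is a Loeb measure: it is the outer measure generated by
    internal sets, and countable saturation gives sigma-additivity.

    A comparison of Borel measures that are finite on balls can be checked on
    open sets.  For the projections, the preimage of an open set is contained in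
    an internal set given by the maps [P i j].  For the factorization of a
    couple [(Y, Q)], a closed set of [Y] is exhausted by totally bounded sets,
    which are transported to internal sets by the maps [Q i].  The factorization
    exists without any assumption on the base point, and it forces the base
    point into the support of the limit measure as soon as some couple projects
    on the system. *)
Require Import Defs.
From mathcomp Require Import all_boot all_order all_algebra generic_quotient.
From mathcomp Require Import all_classical all_reals all_analysis.
From mathcomp Require Import lra.

Set Implicit Arguments.
Unset Strict Implicit.
Unset Printing Implicit Defensive.

Import Order.TTheory GRing.Theory Num.Theory.
Import numFieldNormedType.Exports.

Local Open Scope classical_set_scope.
Local Open Scope ring_scope.

(** * Sigma-algebras and measures on set systems *)

(** Two mismatches shape the proof. The ultralimit need not be separable, so its measure lives on
    the sigma-algebra generated by balls; [limit_space] enters that sigma-algebra only once it is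
    known to be complete, hence closed, and separable. And morphisms are controlled on supports
    only, while an internal neighbourhood of a point also contains families that leave the supports.
    Since the complement of each support is null, such families are absorbed into the internal sets
    at no cost.

    The universal property needs lower bounds on the limit measure. The images of a closed set under
    the maps [Q i] need not be Borel, and the ultraproduct of these images may be far larger than
    the set. Finite unions of balls do commute with ultraproducts, which is why totally bounded sets
    are transported instead. Passing to all scales at once uses continuity from above of the Loeb
    measure, so everything must stay in one ball of finite measure; the bound comes from [X 0],
    since each [P 0 i] is a morphism. *)

Section SigmaAlgebra.
Context {T : Type} {G : set (set T)}.
Hypothesis sG : sigma_algebra setT G.

Lemma sig_set0 : G set0. Proof. by case: sG. Qed.

Lemma sig_setC A : G A -> G (~` A).
Proof. by case: sG => _ GC _ /GC; rewrite setTD. Qed.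

Lemma sig_bigcupT (F : nat -> set T) : (forall n, G (F n)) -> G (\bigcup_n F n).
Proof. by case: sG => _ _; apply. Qed.

Lemma sig_setT : G setT.
Proof. by rewrite -setC0; exact/sig_setC/sig_set0. Qed.

Lemma sig_setU A B : G A -> G B -> G (A `|` B).
Proof.
by move=> GA GB; rewrite -bigcup2E; apply: sig_bigcupT => -[|[|n]] //=;
  exact: sig_set0.
Qed.

Lemma sig_setI A B : G A -> G B -> G (A `&` B).
Proof.
by move=> GA GB; rewrite -(setCK A) -(setCK B) -setCU;
  apply/sig_setC/sig_setU; exact: sig_setC.
Qed.

Lemma sig_setD A B : G A -> G B -> G (A `\` B).
Proof. by move=> GA GB; rewrite setDE; apply: sig_setI => //;
  exact: sig_setC. Qed.

Lemma sig_bigcapT (F : nat -> set T) : (forall n, G (F n)) -> G (\bigcap_n F n).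
Proof.
move=> GF; rewrite -(setCK (\bigcap_n F n)) setC_bigcap.
by apply/sig_setC/sig_bigcupT => n; exact: sig_setC.
Qed.

Lemma sig_bigcup {I : Type} (D : set I) (F : I -> set T) : countable D ->
  (forall i, D i -> G (F i)) -> G (\bigcup_(i in D) F i).
Proof.
move=> /pfcard_geP[->|[f]] GF; first by rewrite bigcup_set0; exact: sig_set0.
rewrite -(image_eq f) bigcup_image; apply: sig_bigcupT => n.
exact/GF/(@funS _ _ _ _ f).
Qed.

Lemma sig_bigsetU (F : nat -> set T) n : (forall k, G (F k)) ->
  G (\big[setU/set0]_(k < n) F k).
Proof.
move=> GF; elim: n => [|n ih]; first by rewrite big_ord0; exact: sig_set0.
by rewrite big_ord_recr /=; exact: sig_setU.
Qed.

End SigmaAlgebra.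

(** * Countably additive set functions on a sigma-algebra *)

Section MeasureOn.
Local Open Scope ereal_scope.
Context {R : realType} {T : Type} {G : set (set T)} {m : set T -> \bar R}.
Hypotheses (sG : sigma_algebra setT G) (mm : measure_on G m).

Lemma mo_set0 : m set0 = 0. Proof. by case: mm. Qed.

Lemma mo_ge0 A : G A -> 0 <= m A. Proof. by case: mm => _ h _; exact: h. Qed.

Lemma mo_sigma_additive (F : nat -> set T) : (forall n, G (F n)) ->
  trivIset setT F -> \sum_(0 <= i <oo) m (F i) = m (\bigcup_n F n).
Proof. by case: mm => _ _ h GF tF; apply/cvg_lim => //; exact: h. Qed.

Lemma mo_additive A B : G A -> G B -> A `&` B = set0 -> m (A `|` B) = m A + m B.
Proof.
move=> GA GB AB; have GF n : G (bigcup2 A B n).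
  by move: n => [|[|n]] //=; exact: (sig_set0 sG).
rewrite -bigcup2E -mo_sigma_additive //; last by rewrite -trivIset_bigcup2.
rewrite (nneseries_split 0 2) => [|k _]; last exact: mo_ge0.
rewrite !big_nat_recr //= big_geq // add0e eseries0 ?adde0 //.
by move=> [|[|n]] //= _ _; exact: mo_set0.
Qed.

Lemma mo_le A B : G A -> G B -> A `<=` B -> m A <= m B.
Proof.
move=> GA GB AB; rewrite -(setDUK AB) mo_additive //.
- by rewrite leeDl // mo_ge0 //; exact: (sig_setD sG).
- exact: (sig_setD sG).
- by rewrite setDE setICA setICr setI0.
Qed.

Lemma mo_setU_le A B : G A -> G B -> m (A `|` B) <= m A + m B.
Proof.
move=> GA GB; have GD := sig_setD sG GB GA.
have -> : A `|` B = A `|` (B `\` A).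
  apply/seteqP; split=> x []; [by left| |by left|by case=> *; right].
  by move=> Bx; have [Ax|nAx] := pselect (A x); [left|right].
rewrite mo_additive //; last by rewrite setDE setICA setICr setI0.
by rewrite leeD2l // mo_le // => x [].
Qed.
Lemma mo_setD A B : G A -> G B -> A `<=` B -> m A < +oo ->
  m (B `\` A) = m B - m A.
Proof.
move=> GA GB AB Aoo; have GD := sig_setD sG GB GA.
rewrite -{2}(setDUK AB) mo_additive //; last by rewrite setDE setICA setICr
  setI0.
by rewrite addeAC subee ?add0e // ge0_fin_numE // mo_ge0.
Qed.
Lemma mo_bigcup_le (F : nat -> set T) : (forall n, G (F n)) ->
  m (\bigcup_n F n) <= \sum_(0 <= i <oo) m (F i).
Proof.
move=> GF; have GD n : G (seqDU F n).
  by apply: (sig_setD sG) => //; exact: (sig_bigsetU sG).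
rewrite seqDU_bigcup_eq -(mo_sigma_additive GD);
  last exact: (@trivIset_seqDU _ F).
apply: lee_nneseries => [i _ _|n _]; first exact: mo_ge0.
by apply: mo_le => //; exact: subset_seqDU.
Qed.
Lemma mo_bigcup_null {I : Type} (D : set I) (F : I -> set T) : countable D ->
  (forall i, D i -> G (F i)) -> (forall i, D i -> m (F i) = 0) ->
  m (\bigcup_(i in D) F i) = 0.
Proof.
move=> /pfcard_geP[->|[f]] GF F0; first by rewrite bigcup_set0; exact: mo_set0.
have fD n : D (f n) by exact: (@funS _ _ _ _ f).
rewrite -(image_eq f) bigcup_image; apply/le_anti/andP; split.
  apply: (le_trans (mo_bigcup_le (fun n => GF _ (fD n)))).
  by rewrite eseries0 // => i _ _; exact: F0.
by apply/mo_ge0/(sig_bigcupT sG) => n; exact: GF.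
Qed.
Lemma mo_nondecreasing_cvg (F : nat -> set T) : (forall n, G (F n)) ->
  nondecreasing_seq F -> m (F n) @[n --> \oo] --> m (\bigcup_n F n).
Proof.
move=> GF ndF; have GD n : G (seqD F n).
  by case: n => [|n] //=; exact: (sig_setD sG).
have mF n : m (F n) = \sum_(0 <= i < n.+1) m (seqD F i).
  elim: n => [|n ih]; first by rewrite big_nat1.
  have FnS : F n `<=` F n.+1 by exact/subsetPset/ndF.
  rewrite big_nat_recr //= -ih -mo_additive ?setDUK //; first exact: (GD n.+1).
  by rewrite setDE setICA setICr setI0.
case: mm => _ _ /(_ _ GD (trivIset_seqD ndF)); rewrite eq_bigcup_seqD => h.
(* The sums in [measure_on] stop before [n], so [m (F n)] is the partial sum of index [n.+1]. *)
rewrite (_ : (fun n => m (F n)) =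
  (fun n => (fun n => \sum_(0 <= i < n) m (seqD F i)) n.+1)); last exact/funext.
by move: h; rewrite -cvg_shiftS.
Qed.
Lemma mo_nondecreasing_sup (F : nat -> set T) : (forall n, G (F n)) ->
  nondecreasing_seq F -> m (\bigcup_n F n) = ereal_sup (range (m \o F)).
Proof.
move=> GF ndF; apply: (cvg_unique _ (mo_nondecreasing_cvg GF ndF)) => //.
apply: ereal_nondecreasing_cvgn => n k nk.
by apply: mo_le => //; exact/subsetPset/ndF.
Qed.
(** Continuity from above, in the one-sided form in which it serves: it refutes a positive lower
    bound when the intersection is empty, and it bounds the Loeb measure of an intersection from
    below. Complements in [F 0%N] reduce it to continuity from below. *)
Lemma mo_nonincreasing_ge (F : nat -> set T) c : (forall n, G (F n)) ->
  nonincreasing_seq F -> m (F 0%N) < +oo -> (forall n, c <= m (F n)) ->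
  c <= m (\bigcap_n F n).
Proof.
move=> GF niF F0 cF.
have sub n : F n `<=` F 0%N by apply/subsetPset/niF.
have Foo n : m (F n) < +oo by apply: le_lt_trans F0; exact: mo_le.
have GI := sig_bigcapT sG GF.
have Ioo : m (\bigcap_n F n) < +oo.
  by apply: le_lt_trans F0; apply: mo_le => // x; apply.
have fin A : G A -> m A < +oo -> m A \is a fin_num.
  by move=> GA ?; rewrite ge0_fin_numE // mo_ge0.
have GD n : G (F 0%N `\` F n) by exact: (sig_setD sG).
have nd : nondecreasing_seq (fun n => F 0%N `\` F n).
  by move=> n k nk; apply/subsetPset; apply: setDS; exact/subsetPset/niF.
have : m (\bigcup_n (F 0%N `\` F n)) <= m (F 0%N) - c.
  rewrite mo_nondecreasing_sup //; apply: ge_ereal_sup => _ [n _ <-] /=.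
  by rewrite mo_setD // leeB.
have -> : \bigcup_n (F 0%N `\` F n) = F 0%N `\` \bigcap_n F n.
  by rewrite setDE setC_bigcap setI_bigcupr.
rewrite mo_setD //; last by move=> x; apply.
have := fin _ (GF 0%N) F0; have := fin _ GI Ioo.
move: (m (\bigcap_n F n)) (m (F 0%N)) (cF 0%N) => [a| |] // [b| |] //.
by case: c {cF} => [c| |] //=; rewrite ?leNye // !lee_fin => _ _ _;
  rewrite lerD2l lerN2.
Qed.
(** Restriction to a ball turns a measure that is finite on balls into a finite one, to which
    [finite_measure_regular] applies. *)
Lemma mo_setIr A : G A -> measure_on G (fun B => m (B `&` A)).
Proof.
move=> GA; split=> [|B GB|F GF tF]; first by rewrite set0I mo_set0.
  by apply: mo_ge0; exact: (sig_setI sG).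
rewrite setI_bigcupl; case: mm => _ _; apply; last exact: trivIset_setIr.
by move=> n; exact: (sig_setI sG).
Qed.
End MeasureOn.

(** * Metric spaces *)

Section MetricTopology.
Context {R : realType} {T : metricType R}.
Implicit Types (x y : T) (r e : R) (A B C D S U : set T).

Lemma ball_mdist x r y : ball x r y <-> (mdist x y < r)%R.
Proof. by rewrite ballEmdist. Qed.

Lemma open_mdistP U :
  open U <-> forall x, U x -> exists2 r, 0 < r & ball x r `<=` U.
Proof.
rewrite openE; split=> [oU x /oU /nbhs_ballP[r /= r0 rU]|h x /h[r r0 rU]].
  by exists r.
by apply/nbhs_ballP; exists r.
Qed.

Lemma closed_mdistP C : closed C <->
  forall x, (forall e, 0 < e -> exists2 y, C y & mdist x y < e) -> C x.
Proof.
split=> [cC x h|h x cx].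
  apply: cC => B /nbhs_ballP[e /= e0 eB]; have [y Cy xy] := h _ e0.
  by exists y; split => //; apply: eB; apply/ball_mdist.
apply: h => e e0; have [|y [Cy /ball_mdist xy]] := cx (ball x e);
  last by exists y.
exact: nbhsx_ballx.
Qed.

Lemma ball_open_mdist x r : open (ball x r).
Proof.
apply/open_mdistP => y /ball_mdist xy; exists (r - mdist x y);
  first by rewrite subr_gt0.
move=> z /ball_mdist yz; apply/ball_mdist.
by rewrite (le_lt_trans (metric_triangle x y z)) // -ltrBrDl.
Qed.

Lemma ball_sub_ball x y r e : mdist x y + e <= r -> ball y e `<=` ball x r.
Proof.
move=> xyr z /ball_mdist yz; apply/ball_mdist.
by rewrite (le_lt_trans (metric_triangle x y z)) // (lt_le_trans _ xyr) //
  ltrD2l.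
Qed.

Lemma borel_sigma_algebra : sigma_algebra setT (@borel T).
Proof. exact: smallest_sigma_algebra. Qed.

Lemma ball_algebra_sigma_algebra : sigma_algebra setT (@ball_algebra R T).
Proof. exact: smallest_sigma_algebra. Qed.

Lemma borel_open U : open U -> borel U.
Proof. exact: sub_sigma_algebra. Qed.

Lemma borel_closed C : closed C -> borel C.
Proof.
move=> /closed_openC /borel_open /(sig_setC borel_sigma_algebra).
by rewrite setCK.
Qed.

Lemma borel_ball x r : borel (ball x r).
Proof. by apply: borel_open; exact: ball_open_mdist. Qed.

Lemma ball_algebra_ball x r : ball_algebra (ball x r).
Proof. by apply: sub_sigma_algebra; exists x, r. Qed.

Lemma ball_algebra_sub_borel : @ball_algebra R T `<=` @borel T.
Proof.
apply: smallest_sub; first exact: borel_sigma_algebra.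
by move=> _ [x [r ->]]; exact: borel_ball.
Qed.

(* [D] need not be contained in [S]. *)
Definition approximated_by D S :=
  forall x e, S x -> 0 < e -> exists2 d, D d & mdist d x < e.

Lemma separable_approximated : separable_space T ->
  exists2 D, countable D & approximated_by D setT.
Proof.
move=> [D cD dD]; exists D => // x e _ e0.
have [||d [/ball_mdist xd Dd]] := dD (ball x e).
- by exists x; exact: ballxx.
- exact: ball_open_mdist.
by exists d => //; rewrite metric_sym.
Qed.

(** The Lindelof property with an explicit index set: among the countably many balls of radius
    [1 / (n + 1)] centred in [D], [J] keeps those that fit into a prescribed ball. *)
Lemma lindelof_ball D S (r : T -> R) : countable D -> approximated_by D S ->
  (forall x, S x -> 0 < r x) ->
  exists J : set (T * nat), [/\ countable J,
    S `<=` \bigcup_(j in J) ball j.1 j.2.+1%:R^-1 &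
    forall j, J j -> exists2 x, S x & ball j.1 j.2.+1%:R^-1 `<=` ball x (r x)].
Proof.
move=> cD DS r0.
exists [set j | D j.1 /\
  exists2 x, S x & ball j.1 j.2.+1%:R^-1 `<=` ball x (r x)]; split.
- apply: (@sub_countable _ _ _ (D `*` [set: nat])); last exact: countableX.
  by apply: subset_card_le => j [].
- move=> x Sx; have rx := r0 _ Sx.
  (* Half of [r x] leaves room twice for [1 / (n + 1)]: once for the distance from [d] to [x], once
     for the radius. *)
  have [n] := ltr_add_invr (divr_gt0 rx (ltr0Sn R 1)); rewrite add0r => nr.
  have [d Dd dx] := DS x n.+1%:R^-1 Sx (ltac:(by rewrite invr_gt0 ltr0Sn)).
  exists (d, n); last exact/ball_mdist.
  split=> //; exists x => //=; apply: ball_sub_ball.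
  by rewrite metric_sym [leRHS]splitr lerD // ltW // (lt_trans dx).
- by move=> j [].
Qed.
End MetricTopology.

(** * Separable sets and the sigma-algebra generated by balls *)

Section Separability.
Context {R : realType} {T : metricType R}.
Implicit Types (x y : T) (r e : R) (A B C D S U : set T).

Lemma approximated_by_subset D S S' :
  S' `<=` S -> approximated_by D S -> approximated_by D S'.
Proof. by move=> SS DS x e /SS; exact: DS. Qed.

(** Density has to be witnessed inside [A], but the points of [D] may lie outside. Each pair
    [(d, n)] is therefore replaced by a point of [A] within [1 / (n + 1)] of [d] whenever there is
    one. *)
Lemma approximated_separable A D : countable D -> approximated_by D A ->
  separable_space A.
Proof.
move=> cD DA.
have [a0|nA] := pselect (exists a : A, True); last first.
  by exists set0 => // O [a _]; case: nA; exists a.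
have /choice[f fP] (dn : T * nat) : exists a : A, forall b : A,
    mdist dn.1 (set_val b) < dn.2.+1%:R^-1 ->
    mdist dn.1 (set_val a) < dn.2.+1%:R^-1.
  have [[b bP]|nb] := pselect (exists b : A, mdist dn.1 (set_val b) <
    dn.2.+1%:R^-1).
    by exists b.
  by case: a0 => a _; exists a => b bP; case: nb; exists b.
exists (f @` (D `*` [set: nat])).
  by apply: (sub_countable (card_image_le _ _)); exact: countableX.
move=> O [a Oa] /open_mdistP/(_ _ Oa)[r r0 rO].
have [n] := ltr_add_invr (divr_gt0 r0 (ltr0Sn R 1)); rewrite add0r => nr.
have [d Dd da] := DA (set_val a) n.+1%:R^-1 (set_valP a) (ltac:(by rewrite
  invr_gt0 ltr0Sn)).
exists (f (d, n)); split; last by exists (d, n).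
apply/rO/ball_mdist; rewrite -[mdist _ _]/(mdist (set_val a) (set_val _)).
rewrite (le_lt_trans (metric_triangle _ d _)) // [ltRHS]splitr ltrD //.
  by rewrite metric_sym (lt_trans da).
by rewrite (lt_trans _ nr) //; exact: (fP (d, n) a).
Qed.

Lemma separable_open_ball_algebra U : separable_space T -> open U ->
  exists J : set (T * nat), countable J /\ U = \bigcup_(j in J) ball j.1
    j.2.+1%:R^-1.
Proof.
move=> /separable_approximated[D cD DT] oU.
have ch x : {r : R | 0 < r & U x -> ball x r `<=` U}.
  apply: cid2; have [Ux|nUx] := pselect (U x); last by exists 1.
  by have [r r0 rU] := (open_mdistP U).1 oU x Ux; exists r.
have [||J [cJ UJ JU]] := @lindelof_ball _ _ D U (fun x => s2val (ch x)) cD.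
- exact: approximated_by_subset DT.
- by move=> x _; exact: (s2valP (ch x)).
exists J; split=> //; apply/seteqP; split=> // x [j Jj jx].
by have [y Uy /(_ _ jx)] := JU _ Jj; exact: (s2valP' (ch y)).
Qed.

(** Applied to the spaces [X i], it lets families of Borel sets serve as ball families; a
    non-separable ultralimit is out of its reach. *)
Lemma separable_borel_ball_algebra : separable_space T ->
  @borel T = @ball_algebra R T.
Proof.
move=> sT; apply/seteqP; split; last exact: ball_algebra_sub_borel.
apply: smallest_sub; first exact: ball_algebra_sigma_algebra.
move=> U oU; have [J [cJ ->]] := separable_open_ball_algebra sT oU.
by apply: (sig_bigcup ball_algebra_sigma_algebra) => // j _;
  exact: ball_algebra_ball.
Qed.

(** The ambient space may be non-separable here, so [C] is cut out by countable unions of balls of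
    shrinking radius. This is how [limit_space] becomes measurable in the ultralimit. *)
Lemma closed_ball_algebra C D : closed C -> countable D ->
  approximated_by D C ->
  ball_algebra C.
Proof.
move=> cC cD DC.
(* Centres far from [C] are dropped, so that every point of the [n]-th union lies within
   [2 / (n + 1)] of [C]. *)
pose E n := [set d | D d /\ exists2 x, C x & mdist d x < n.+1%:R^-1].
have -> : C = \bigcap_n \bigcup_(d in E n) ball d n.+1%:R^-1.
  apply/seteqP; split=> [x Cx n _|x Ex].
    have [d Dd dx] := DC x n.+1%:R^-1 Cx (ltac:(by rewrite invr_gt0 ltr0Sn)).
    by exists d; [split=> //; exists x|exact/ball_mdist].
  apply: ((closed_mdistP C).1 cC) => e e0.
  have [n] := ltr_add_invr (divr_gt0 e0 (ltr0Sn R 1)); rewrite add0r => ne.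
  have [d [_ [y Cy dy]] /ball_mdist dx] := Ex n Logic.I.
  exists y => //; rewrite (le_lt_trans (metric_triangle x d y)) //.
  by rewrite [ltRHS]splitr ltrD // ?(lt_trans _ ne) // metric_sym.
apply: (sig_bigcapT ball_algebra_sigma_algebra) => n.
apply: (sig_bigcup ball_algebra_sigma_algebra) => [|d _].
  by apply: (sub_countable _ cD); apply: subset_card_le => d [].
exact: ball_algebra_ball.
Qed.

End Separability.

(** * The support of a measure *)

Section Support.
Local Open Scope ereal_scope.
Context {R : realType} {T : metricType R} {G : set (set T)} {m : set T ->
  \bar R}.
Hypotheses (sG : sigma_algebra setT G) (mm : measure_on G m).
Hypothesis Gball : forall x (r : R), G (ball x r).

Lemma spt_closed : closed (spt m).
Proof.
apply/closed_mdistP => x h r r0.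
have r20 : (0 < r / 2)%R by rewrite divr_gt0.
have [y my xy] := h _ r20; apply: (lt_le_trans (my _ r20)).
apply: (mo_le sG mm) => //; apply: ball_sub_ball.
by rewrite [leRHS]splitr lerD2r ltW.
Qed.

(** Every point off the support has a null ball; by the Lindelof argument countably many small balls
    contained in such balls cover the complement. *)
Lemma spt_setC_null : G (spt m) -> separable_space T -> m (~` spt m) = 0.
Proof.
move=> Gs /separable_approximated[D cD DT].
have ch x : {r : R | (0 < r)%R & (~` spt m) x -> m (ball x r) = 0}.
  apply: cid2; have [sx|nsx] := pselect (spt m x).
    by exists 1%R.
  have [r /not_implyP[r0 /negP]] := (existsNP _).2 nsx.
  rewrite -leNgt => r1; exists r => // _; apply/le_anti; rewrite r1.
  exact: (mo_ge0 mm).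
have [||J [cJ SJ JS]] := @lindelof_ball _ _ D (~` spt m) (fun x =>
  s2val (ch x)) cD.
- exact: approximated_by_subset DT.
- by move=> x _; exact: (s2valP (ch x)).
have J0 j : J j -> m (ball j.1 j.2.+1%:R^-1) = 0.
  move=> /JS[x sx jx]; apply/le_anti; rewrite (mo_ge0 mm) // andbT.
  by rewrite -(s2valP' (ch x) sx); exact: (mo_le sG mm).
apply/le_anti; rewrite (mo_ge0 mm) ?andbT //; last exact: (sig_setC sG).
rewrite -(mo_bigcup_null sG mm cJ _ J0) //; apply: (mo_le sG mm) => //.
  exact: (sig_setC sG).
exact: (sig_bigcup sG).
Qed.

(* A maximal [eps]-separated subset of the support is countable: the balls of
   radius [eps / 2] around its points are disjoint and of positive measure. *)
Lemma spt_approximated : (forall x r, m (ball x r) < +oo) ->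
  exists2 D, countable D & approximated_by D (spt m).
Proof.
move=> fin.
have [[x0 _]|/set0P/negP/negPn/eqP ->] := pselect (spt m !=set0); last first.
  by exists set0 => //; move=> x e [].
pose sep (e : R) (A : set T) := A `<=` spt m /\
  forall a b, A a -> A b -> (mdist a b < e)%R -> a = b.
have maxA e : exists A, sep e A /\ forall B, A `<` B -> ~ sep e B.
  apply: Zorn_bigcup => F Fsep totF; split=> [x [A FA Ax]|a b [A FA Aa] [B FB
    Bb]].
    by apply: (Fsep _ FA).1.
  by have [AB|BA] := totF _ _ FA FB; [apply: (Fsep _ FB).2|apply:
    (Fsep _ FA).2];
    rewrite //; [exact: AB|exact: BA].
have [A AP] := choice maxA.
exists (\bigcup_n A n.+1%:R^-1)%R; last first.
  move=> x e sx e0; have [n] := ltr_add_invr e0; rewrite add0r => ne.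
  have [[sA Ainj] Amax] := AP n.+1%:R^-1%R.
  apply: contrapT => nd.
  have far a : A n.+1%:R^-1%R a -> ~ (mdist a x < n.+1%:R^-1)%R.
    by move=> Aa ax; apply: nd; exists a; [exists n|exact: lt_trans ne].
  have nAx : ~ A n.+1%:R^-1%R x by move=> /far; rewrite mdistxx invr_gt0 ltr0Sn.
  apply: (Amax (A n.+1%:R^-1%R `|` [set x])).
    by split=> [y Ay|]; [left|move=> /(_ x); apply: contra_not nAx; apply;
      right].
  split=> [y [/sA //|-> //]|a b [Aa|->] [Ab|->] //]; first exact: Ainj.
    by move=> /(far _ Aa).
  by rewrite metric_sym => /(far _ Ab).
apply: bigcup_countable => // n _.
have [[sA Ainj] _] := AP n.+1%:R^-1%R.
set e := n.+1%:R^-1%R in sA Ainj *; have e0 : (0 < e / 2)%R.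
  by rewrite divr_gt0 // invr_gt0 ltr0Sn.
(* A ball of finite measure contains only finitely many disjoint balls of measure above
   [1 / (l + 1)], so each piece [L (k, l)] is finite. *)
pose L (kl : nat * nat) := [set a | [/\ A e a, (mdist x0 a < kl.1%:R)%R &
  kl.2.+1%:R^-1%:E < m (ball a (e / 2))]].
have -> : A e = \bigcup_kl L kl.
  apply/seteqP; split=> [a Aa|a [kl _ []] //].
  have [k ak] : exists k : nat, (mdist x0 a < k%:R)%R.
    by exists (Num.truncn (mdist x0 a)).+1; exact: truncnS_gt.
  have : 0 < m (ball a (e / 2)) by exact: sA.
  rewrite -(fineK (_ : m (ball a (e / 2)) \is a fin_num)); last first.
    by rewrite ge0_fin_numE //; exact: (mo_ge0 mm).
  rewrite lte_fin => /ltr_add_invr[l]; rewrite add0r => la.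
  exists (k, l) => //; split => //=.
  by rewrite -(fineK (_ : m (ball a (e / 2)) \is a fin_num)) ?lte_fin //
     ge0_fin_numE //; exact: (mo_ge0 mm).
apply: bigcup_countable => // -[k l] _; apply: finite_set_countable.
apply: contrapT => /infiniteP/card_leP[g].
pose f (i : nat) : T := set_val (g (exist _ i (mem_set Logic.I))).
have fL i : L (k, l) (f i) by exact: set_valP.
have finj i j : (mdist (f i) (f j) < e)%R -> i = j.
  move=> ij; suff : f i = f j.
    by move=> /val_inj/(@inj _ _ _ g) h; have := h (mem_set Logic.I) (mem_set
      Logic.I); case.
  by apply: Ainj => //; [have [] := fL i|have [] := fL j].
have tF : trivIset setT (fun i => ball (f i) (e / 2)).
  move=> i j _ _ [y [/ball_mdist iy /ball_mdist jy]]; apply: finj.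
  rewrite (le_lt_trans (metric_triangle _ y _)) // [ltRHS]splitr ltrD //.
  by rewrite metric_sym.
have mF := mo_sigma_additive mm (fun i => Gball _ _) tF.
have : m (\bigcup_i ball (f i) (e / 2)) < +oo.
  apply: le_lt_trans (fin x0 (k%:R + e / 2)%R); apply: (mo_le sG mm) => //.
    by apply: (sig_bigcupT sG) => i.
  move=> y [i _ iy]; apply: ball_sub_ball iy.
  by rewrite lerD2r ltW //; have [] := fL i.
rewrite -mF; apply/negP; rewrite -leNgt.
have h (N : nat) : (N%:R * l.+1%:R^-1)%:E <= \sum_(0 <= i <oo) m (ball (f i) (e
  / 2)).
  apply: le_trans (nneseries_lim_ge N _); last by move=> *; exact: (mo_ge0 mm).
  elim: N => [|N ih]; first by rewrite big_geq // mul0r.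
  rewrite big_nat_recr //= -natr1 mulrDl mul1r EFinD leeD // ltW //.
  by have [] := fL N.
rewrite leye_eq; apply/eqP; move: h; case: (\sum_(0 <= i <oo) _) =>
  [s| |] // h; exfalso.
  have := h (Num.truncn (`|s| * l.+1%:R)).+1; rewrite lee_fin leNgt;
    apply/negP/negPn.
  rewrite (le_lt_trans (ler_norm s)) // -ltr_pdivrMr ?invr_gt0 ?ltr0Sn // invrK.
  exact: truncnS_gt.
by have := h 0%N; rewrite leeNy_eq.
Qed.

End Support.

(** * Regularity and comparison of Borel measures *)

Section OuterRegularity.
Local Open Scope ereal_scope.
Context {R : realType} {T : metricType R}.
Implicit Types (mu nu : set T -> \bar R) (A B C F U : set T).

Let sB := @borel_sigma_algebra R T.

Lemma open_bigcup_closed U : open U -> exists F : nat -> set T,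
  [/\ forall n, closed (F n), nondecreasing_seq F & U = \bigcup_n F n].
Proof.
move=> oU; exists (fun n => [set x | forall y, (mdist x y < n.+1%:R^-1)%R ->
  U y]).
split=> [n|n k nk|].
- apply/closed_mdistP => x h y xy.
  have [|z Fz xz] := h (n.+1%:R^-1 - mdist x y)%R; first by rewrite subr_gt0.
  apply: Fz; rewrite (le_lt_trans (metric_triangle z x y)) // metric_sym.
  by rewrite -ltrBrDr.
- apply/subsetPset => x xn y xy; apply: xn; apply: lt_le_trans xy _.
  by rewrite lef_pV2 ?posrE ?ltr0Sn // ler_nat.
- apply/seteqP; split=> [x Ux|x [n _]]; last by apply;
    rewrite mdistxx invr_gt0 ltr0Sn.
  have [r r0 rU] := (open_mdistP U).1 oU x Ux.
  have [n] := ltr_add_invr r0; rewrite add0r => nr; exists n => //= y xy.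
  by apply/rU/ball_mdist; exact: lt_trans nr.
Qed.

(** The sets with such a sandwich form a sigma-algebra that contains the open sets, these being
    increasing unions of closed ones. Stability under complement is the reason to treat inner and
    outer approximation together. *)
Lemma finite_measure_regular nu : measure_on (@borel T) nu -> nu setT < +oo ->
  forall B, borel B -> forall e : R, (0 < e)%R ->
  exists F U, [/\ closed F, open U, F `<=` B, B `<=` U & nu (U `\` F) < e%:E].
Proof.
move=> mnu fin; have fin' A : borel A -> nu A < +oo.
  by move=> bA; apply: le_lt_trans fin; apply: (mo_le sB mnu) => //;
    exact: sig_setT.
have bO U : open U -> borel U by exact: borel_open.
have bF F : closed F -> borel F by exact: borel_closed.
pose reg B := forall e : R, (0 < e)%R ->
  exists F U, [/\ closed F, open U, F `<=` B, B `<=` U & nu (U `\` F) < e%:E].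
suff : @borel T `<=` reg by [].
apply: smallest_sub; last first.
  move=> U oU e e0; have [F [cF ndF UF]] := open_bigcup_closed oU.
  have [n Fn] : exists n, nu (U `\` F n) < e%:E.
    apply: contrapT => /forallNP h.
    have : e%:E <= nu (\bigcap_n (U `\` F n)).
      apply: (mo_nonincreasing_ge sB mnu) => [n|n k nk||n].
      - by apply: (sig_setD sB); [exact: bO|exact: bF].
      - by apply/subsetPset; apply: setDS; exact/subsetPset/ndF.
      - by apply: fin'; apply: (sig_setD sB); [exact: bO|exact: bF].
      - by rewrite leNgt; apply/negP/h.
    have -> : \bigcap_n (U `\` F n) = set0.
      rewrite -subset0 => x Ux; have [Ux0 _] := Ux 0%N Logic.I.
      by move: Ux0; rewrite UF => -[n _ Fx]; have [_] := Ux n Logic.I.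
    by rewrite (mo_set0 mnu) lee_fin leNgt e0.
  by exists (F n), U; split=> //; rewrite UF; exact: bigcup_sup.
split=> [e e0|A rA e e0|A rA e e0].
- exists set0, set0; split=> //; [exact: closed0|exact: open0|].
  by rewrite setD0 (mo_set0 mnu) lte_fin.
- have [F [U [cF oU FA AU UF]]] := rA e e0; exists (~` U), (~` F).
  rewrite setTD; split.
  + exact: open_closedC.
  + exact: closed_openC.
  + exact: subsetC.
  + exact: subsetC.
  + by rewrite setDE setCK setIC -setDE.
- have e2 n : (0 < e / 2 / (2 ^ n.+1)%:R)%R by rewrite !divr_gt0 // ltr0n
    expn_gt0.
  have /choice[FU FUP] n : exists FU : set T * set T, [/\ closed FU.1,
    open FU.2,
      FU.1 `<=` A n, A n `<=` FU.2 & nu (FU.2 `\` FU.1) < (e / 2 / (2 ^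
        n.+1)%:R)%:E].
    by have [F [U h]] := rA n _ (e2 n); exists (F, U).
  have cF n : closed (FU n).1 by have [] := FUP n.
  have oU n : open (FU n).2 by have [] := FUP n.
  (* An infinite union of closed sets need not be closed, so the inner set is a finite union whose
     length is found by continuity from above. The approximations spend only [e / 2], which keeps
     the limit strictly below [e]. *)
  pose U := \bigcup_n (FU n).2; pose F n := \big[setU/set0]_(k < n) (FU k).1.
  have bU : borel U by apply: (sig_bigcupT sB) => n; exact: bO.
  have bFn n : borel (F n) by apply: (@sig_bigsetU _ _ sB (fun k =>
    (FU k).1)) => k; exact: bF.
  have FnE n : F n = \bigcup_(k < n) (FU k).1 by rewrite bigcup_mkord.
  have UFe : nu (U `\` \bigcup_n (FU n).1) <= (e / 2)%:E.
    have le1 := @epsilon_trick0 R (e / 2)%R xpredT (ltW (divr_gt0 e0 (ltr0Sn R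
      1))).
    apply: le_trans le1; have bD n : borel ((FU n).2 `\` (FU n).1).
      by apply: (sig_setD sB); [exact: bO|exact: bF].
    apply: le_trans; last first.
      apply: lee_nneseries => [i _ _|n _]; first exact: (mo_ge0 mnu (bD i)).
      by apply: ltW; have [] := FUP n.
    apply: le_trans (mo_bigcup_le sB mnu bD); apply: (mo_le sB mnu).
    - by apply: (sig_setD sB) => //; apply: (sig_bigcupT sB) => n; exact: bF.
    - exact: (sig_bigcupT sB).
    - by move=> x [[n _ Ux] nF]; exists n => //; split=> // Fx; apply: nF;
        exists n.
  have [n Fn] : exists n, nu (U `\` F n) < e%:E.
    apply: contrapT => /forallNP h.
    have : e%:E <= nu (\bigcap_n (U `\` F n)).
      apply: (mo_nonincreasing_ge sB mnu) => [n|n k nk||n].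
      - exact: (sig_setD sB).
      - by apply/subsetPset; apply: setDS; rewrite !FnE;
          apply: bigcup_subset => i /=
          /leq_trans; apply.
      - by apply: fin'; apply: (sig_setD sB).
      - by rewrite leNgt; apply/negP/h.
    have -> : \bigcap_n (U `\` F n) = U `\` \bigcup_n (FU n).1.
      apply/seteqP; split=> [x Ux|x [Ux nF] n _]; last first.
        by split=> //; rewrite FnE => -[k _ Fx]; apply: nF; exists k.
      split; first by have [] := Ux 0%N Logic.I.
      move=> [n _ Fx]; have [_] := Ux n.+1 Logic.I; apply; rewrite FnE.
      by exists n => /=.
    move=> /le_trans/(_ UFe); rewrite lee_fin leNgt ltr_pdivrMr //.
    by rewrite ltr_pMr // ltr1n.
  exists (F n), U; split=> //.
  + by rewrite FnE; apply: closed_bigcup => // k _; exact: cF.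
  + exact: bigcup_open.
  + by rewrite FnE => x [k _ Fx]; exists k => //; have [_ _ + _ _] := FUP k;
      apply.
  + by move=> x [k _ Ax]; exists k => //; have [_ _ _ + _] := FUP k; apply.
Qed.

(* A measure that is finite on balls is outer regular, so a comparison on open
   sets extends to all Borel sets. *)
Lemma borel_le_open mu nu : measure_on (@borel T) mu ->
  measure_on (@borel T) nu ->
  (forall x r, nu (ball x r) < +oo) -> (forall U, open U -> mu U <= nu U) ->
  forall B, borel B -> mu B <= nu B.
Proof.
move=> mmu mnu fin munu B bB.
have [[x0 _]|/set0P/negP/negPn/eqP ->] := pselect (B !=set0); last first.
  by rewrite (mo_set0 mmu) (mo_set0 mnu).
apply/lee_addgt0Pr => e e0.
have e2 n : (0 < e / (2 ^ n.+1)%:R)%R by rewrite !divr_gt0 // ltr0n expn_gt0.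
pose b (n : nat) := ball x0 n%:R; have bb n : borel (b n) by exact: borel_ball.
(* The total mass of [nu] may be infinite, so regularity is applied to its restriction to each
   [b n], with errors summing to [e]; the traces of [V n] on [b n] are then glued into the open set
   [W]. *)
have /choice[V VP] n : exists V : set T, [/\ open V, B `<=` V &
    nu ((V `\` B) `&` b n) <= (e / (2 ^ n.+1)%:R)%:E].
  have mn := mo_setIr sB mnu (bb n).
  have [|F [V [cF oV FB BV VF]]] := finite_measure_regular mn _ bB (e2 n).
    by rewrite setTI; exact: fin.
  exists V; split=> //; apply: le_trans (ltW VF).
  apply: (mo_le sB mn); last by apply: setDS.
  - by apply: (sig_setD sB) => //; exact: borel_open.
  - by apply: (sig_setD sB); [exact: borel_open|exact: borel_closed].
pose W := \bigcup_n (V n `&` b n).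
have oV n : open (V n `&` b n).
  by have [oV _ _] := VP n; apply: openI => //; exact: ball_open_mdist.
have oW : open W by apply: bigcup_open.
have BW : B `<=` W.
  move=> x Bx; exists (Num.truncn (mdist x0 x)).+1 => //; split.
    by have [_ + _] := VP (Num.truncn (mdist x0 x)).+1; apply.
  by apply/ball_mdist; exact: truncnS_gt.
have bW : borel W by exact: borel_open.
apply: (le_trans (mo_le sB mmu bB bW BW)); apply: (le_trans (munu _ oW)).
rewrite -{1}(setDUK BW); have bD : borel (W `\` B) by exact: (sig_setD sB).
apply: (le_trans (mo_setU_le sB mnu bB bD)); rewrite leeD2l //.
have bE n : borel ((V n `\` B) `&` b n).
  apply: (sig_setI sB) => //; apply: (sig_setD sB) => //; apply: borel_open.
  by have [] := VP n.
apply: le_trans (@epsilon_trick0 R e xpredT (ltW e0)).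
apply: le_trans; last first.
  apply: lee_nneseries => [i _ _|n _]; first exact: (mo_ge0 mnu (bE i)).
  by have [] := VP n.
apply: le_trans (mo_bigcup_le sB mnu bE); apply: (mo_le sB mnu) => //.
  exact: (sig_bigcupT sB).
by move=> x [[n _ [Vx bx]] nB]; exists n.
Qed.

End OuterRegularity.

(** * Ultralimits and internal sets *)

Section Ultralimits.
Local Open Scope ereal_scope.
Context {R : realType} {omega : set_system nat} {UF : UltraFilter omega}.

Lemma ultra_setC (S : set nat) : ~ omega S -> omega (~` S).
Proof. by have [|] := in_ultra_setVsetC S UF. Qed.

Lemma ultra_setU (S S' : set nat) : omega (S `|` S') -> omega S \/ omega S'.
Proof.
move=> SS; have [|nS] := in_ultra_setVsetC S UF; first by left.
by right; apply: filterS2 SS nS => i [].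
Qed.

(** If the tail from [n] lies in [omega], then so does [[set n]] or the tail from [n + 1]; the
    former would make [omega] principal. *)
Lemma ultra_cofinite : nonprincipal omega -> forall n,
  omega [set i | (n <= i)%N].
Proof.
move=> np; elim=> [|n ih]; first exact: nearW.
have : omega ([set n] `|` [set i | (n < i)%N]).
  by apply: filterS ih => i /=; rewrite leq_eqVlt => /orP[/eqP ->|];
    [left|right].
move=> /ultra_setU[|//] on; case: (np n); apply/seteqP; split=> [S oS|S nS].
  apply/principal_filterP.
  by have [i [/= <- Si]] := filter_ex (filterI on oS).
by move/principal_filterP : nS => Sn; apply: filterS on => i ->.
Qed.

Lemma ultra_cvge (f : nat -> \bar R) : (forall i, 0 <= f i) ->
  f i @[i --> omega] --> lim (f i @[i --> omega]).
Proof.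
move=> f0; suff [l fl] : exists l : \bar R, f i @[i --> omega] --> l.
  by have -> : lim (f i @[i --> omega]) = l by apply/cvg_lim.
have [fin|ninf] := in_ultra_setVsetC [set i | f i < +oo] UF; last first.
  exists +oo; apply: cvg_near_cst; apply: filterS ninf => i /= /negP.
  by rewrite ltey negbK => /eqP.
have [l _ fl] := @ultra_cvg_nneg R omega UF (fine \o f) (fun i =>
  fine_ge0 (f0 i)).
exists l; apply: cvg_trans fl; apply: near_eq_cvg; apply: filterS fin => i fi.
by rewrite /= fineK // ge0_fin_numE.
Qed.

Lemma ultra_lim_le (f g : nat -> \bar R) : (forall i, 0 <= f i) ->
  (forall i, 0 <= g i) -> (\forall i \near omega, f i <= g i) ->
  lim (f i @[i --> omega]) <= lim (g i @[i --> omega]).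
Proof. by move=> f0 g0; apply: lee_cvg_to; exact: ultra_cvge. Qed.

Lemma ultra_lim_cst (c : \bar R) : lim (c @[_ --> omega]) = c.
Proof. exact: lim_cst. Qed.

Lemma ultra_lim_ge0 (f : nat -> \bar R) : (forall i, 0 <= f i) ->
  0 <= lim (f i @[i --> omega]).
Proof.
by move=> f0; rewrite -{1}(ultra_lim_cst 0); apply: ultra_lim_le => //;
  exact: nearW.
Qed.

Lemma ultra_lim_lt (f : nat -> \bar R) c : (forall i, 0 <= f i) ->
  lim (f i @[i --> omega]) < c -> \forall i \near omega, f i < c.
Proof.
move=> f0 fc; apply: (ultra_cvge f0 (t := [set y | y < c])).
exact: open_ereal_lt'.
Qed.

Lemma ultra_limD (f g : nat -> \bar R) : (forall i, 0 <= f i) ->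
  (forall i, 0 <= g i) -> lim (f i + g i @[i --> omega]) =
  lim (f i @[i --> omega]) + lim (g i @[i --> omega]).
Proof.
move=> f0 g0; apply/cvg_lim => //; apply: cvgeD; try exact: ultra_cvge.
by rewrite ge0_adde_def ?inE ?ultra_lim_ge0.
Qed.

End Ultralimits.

(** * Measures of pointed Polish spaces *)

Section Pmms.
Local Open Scope ereal_scope.
Context {R : realType} (X : pmms R).

Let sB := @borel_sigma_algebra R X.

Lemma pmms_measure_on : measure_on (@borel X) (pmms_measure X).
Proof. by have [] := pmms_polish X. Qed.

Lemma pmms_complete : complete_space X.
Proof. by have [] := pmms_polish X. Qed.

Lemma pmms_separable : separable_space X.
Proof. by have [] := pmms_polish X. Qed.

Lemma pmms_ball_lty (x : X) (r : R) : pmms_measure X (ball x r) < +oo.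
Proof. by have [_ _ _] := pmms_polish X; apply. Qed.

Lemma pmms_spt_closed : closed (spt (pmms_measure X)).
Proof. by apply: (spt_closed sB pmms_measure_on); exact: borel_ball. Qed.

(** The complement of the support is null by separability. Hence what is known of a morphism on the
    support alone suffices to compare measures. *)
Lemma pmms_measure_le A B : borel A -> borel B ->
  A `&` spt (pmms_measure X) `<=` B -> pmms_measure X A <= pmms_measure X B.
Proof.
move=> bA bB AB; have bs := borel_closed pmms_spt_closed.
have bC := sig_setC sB bs.
have -> : pmms_measure X B = pmms_measure X B + pmms_measure X (~` spt
  (pmms_measure X)).
  rewrite (spt_setC_null sB pmms_measure_on) ?adde0 //;
    last exact: pmms_separable.
  exact: borel_ball.
apply: le_trans (mo_setU_le sB pmms_measure_on bB bC).
apply: (mo_le sB pmms_measure_on) => //; first exact: (sig_setU sB).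
move=> x Ax; have [sx|nsx] := pselect (spt (pmms_measure X) x); last by right.
by left; apply: AB.
Qed.

End Pmms.

(** * Internal sets and their measure *)

Section InternalSets.
Local Open Scope ereal_scope.
Context {R : realType} {omega : set_system nat} {UF : UltraFilter omega}.
Context {X : nat -> pmms R}.
Implicit Types A : set_family X.

Local Notation base := (fun i => pmms_point (X i)).
Local Notation m i := (pmms_measure (X i)).
Local Notation pb r := (fun i => ball (pmms_point (X i)) r : set (X i)).

Lemma ball_familyP A : ball_family A <-> forall i, borel (A i).
Proof.
by split=> bA i; have := bA i; rewrite separable_borel_ball_algebra //;
  exact: pmms_separable.
Qed.

Lemma fdist_le (x y : Defs.family X) (r : R) :
  (\forall i \near omega, (mdist (x i) (y i) <= r)%R) ->
    fdist omega x y <= r%:E.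
Proof.
move=> xy; apply: (cvge_to_le (@fdist_cvg _ _ _ _ x y)).
by apply: filterS xy => i; rewrite lee_fin.
Qed.

Lemma fdist_lt (x y : Defs.family X) (r : R) : fdist omega x y < r%:E ->
  \forall i \near omega, (mdist (x i) (y i) < r)%R.
Proof.
move=> /ultra_lim_lt h; apply: filterS (h _) => [i|i]; first by rewrite lte_fin.
by rewrite lee_fin mdist_ge0.
Qed.

Lemma finite_part_ex (x : Defs.family X) : fdist omega x base < +oo ->
  exists u : finite_part omega X, val u = \pi_(ultraproduct omega X)%qT x.
Proof.
move=> xfin; have h : \pi_(ultraproduct omega X)%qT x \in finite_part omega X.
  by apply/mem_set; rewrite /finite_part /= dbarE.
by exists (exist (fun v => v \in finite_part omega X) _ h).
Qed.

Lemma internalE A (u : finite_part omega X) (x : Defs.family X) :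
  val u = \pi_(ultraproduct omega X)%qT x ->
  internal omega A u <-> \forall i \near omega, A i (x i).
Proof.
move=> ux; rewrite /internal /= ux.
by split=> h; apply: filterS2 (repr_aeq x) h => i ->.
Qed.

Lemma internalU A A' :
  internal omega (fun i => A i `|` A' i) = internal omega A `|` internal omega
    A'.
Proof.
apply/seteqP; split=> u; first exact: ultra_setU.
by move=> [] h; apply: filterS h => i ?; [left|right].
Qed.

Lemma internalI A A' :
  internal omega (fun i => A i `&` A' i) = internal omega A `&` internal omega
    A'.
Proof.
apply/seteqP; split=> u; last by case; exact: filterI.
by move=> h; split; apply: filterS h => i [].
Qed.

Lemma internalC A : internal omega (fun i => ~` A i) = ~` internal omega A.
Proof.
apply/seteqP; split=> u h; last exact: ultra_setC.
by move=> h'; have [i []] := filter_ex (filterI h h').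
Qed.

Lemma internalD A A' :
  internal omega (fun i => A i `\` A' i) = internal omega A `\` internal omega
    A'.
Proof. by rewrite setDE -internalC -internalI. Qed.

Lemma sub_internal A A' : (forall i, A i `<=` A' i) ->
  internal omega A `<=` internal omega A'.
Proof. by move=> AA u; apply: filterS => i; exact: AA. Qed.

Lemma internal_ball_exhaust (u : finite_part omega X) :
  exists n : nat, internal omega (pb n%:R) u.
Proof.
have /set_mem := valP u; rewrite /finite_part /= -(reprK (val u)) dbarE.
move=> ufin; pose l := fine (fdist omega (repr (val u)) base).
exists (Num.truncn l).+1.
have : fdist omega (repr (val u)) base < (Num.truncn l).+1%:R%:E.
  have := truncnS_gt l; rewrite -lte_fin fineK // ge0_fin_numE //.
  exact: fdist_ge0.
by move=> /fdist_lt; apply: filterS => i h; apply/ball_mdist;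
  rewrite metric_sym.
Qed.

(** If the inclusion failed for [omega]-a.e. [i], counterexamples chosen coordinatewise would form a
    family that violates the hypothesis; the ball of radius [r] keeps this family in the finite
    part. *)
Lemma internal_sub A A' (r : R) :
  internal omega A `&` internal omega (pb r) `<=` internal omega A' ->
  \forall i \near omega, A i `&` pb r i `<=` A' i.
Proof.
move=> AA; apply: contrapT => /ultra_setC nA.
have xP i : {y : X i | ~ (A i `&` pb r i `<=` A' i) ->
    [/\ A i y, pb r i y & ~ A' i y]}.
  apply: cid; have [h|] := pselect (A i `&` pb r i `<=` A' i).
    by exists (pmms_point (X i)).
  by move=> /existsNP[y /not_implyP[[Ay By] nA'y]]; exists y.
pose x : Defs.family X := fun i => sval (xP i).
have xA : \forall i \near omega, [/\ A i (x i), pb r i (x i) & ~ A' i (x i)].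
  by apply: filterS nA => i; exact: (svalP (xP i)).
have [|u ux] := @finite_part_ex x.
  apply: (@le_lt_trans _ _ r%:E); last exact: ltry.
  apply: fdist_le; apply: filterS xA => i [_ /ball_mdist xi _].
  by rewrite metric_sym ltW.
have : internal omega A' u.
  by apply: AA; split; apply/(internalE _ ux); apply: filterS xA => i [].
move=> /(internalE _ ux) h; have [i [? [_ _]]] := filter_ex (filterI h xA).
by [].
Qed.

(** The inner limit of [internal_measure]. It is nondecreasing in [r], so the outer limit is a
    supremum. *)
Definition vol_ball A (r : R) : \bar R :=
  lim (m i (A i `&` pb r i) @[i --> omega]).

Lemma ball_family_ballI A r i : ball_family A -> borel (A i `&` pb r i).
Proof.
move=> /ball_familyP bA; apply: (sig_setI (@borel_sigma_algebra _ _)) => //.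
exact: borel_ball.
Qed.

Lemma measure_ballI_ge0 A r : ball_family A -> forall i,
  0 <= m i (A i `&` pb r i).
Proof.
by move=> bA i; apply: (mo_ge0 (pmms_measure_on (X i)));
  exact: ball_family_ballI.
Qed.
Hint Resolve measure_ballI_ge0 ball_family_ballI : core.

Lemma measure_ballI_le A A' r r' i : ball_family A -> ball_family A' ->
  A i `&` pb r i `<=` A' i -> (r <= r')%R ->
  m i (A i `&` pb r i) <= m i (A' i `&` pb r' i).
Proof.
move=> bA bA' AA rr; apply: (mo_le (@borel_sigma_algebra _ _) (pmms_measure_on
  (X i))); auto.
by move=> y [Ay By]; split; [exact: AA|exact: le_ball By].
Qed.

Lemma vol_ball_le A A' r r' : ball_family A -> ball_family A' -> (r <= r')%R ->
  (internal omega A `&` internal omega (pb r) `<=` internal omega A') ->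
  vol_ball A r <= vol_ball A' r'.
Proof.
move=> bA bA' rr /internal_sub AA; apply: ultra_lim_le; auto.
by apply: filterS AA => i AA; exact: measure_ballI_le.
Qed.

Lemma vol_ball_ge0 A r : ball_family A -> 0 <= vol_ball A r.
Proof. by move=> bA; apply: ultra_lim_ge0; auto. Qed.

Lemma vol_ball_cvg A : ball_family A ->
  vol_ball A r @[r --> +oo%R] --> ereal_sup (range (vol_ball A)).
Proof.
move=> bA; apply: nondecreasing_cvge => r r' rr.
by apply: vol_ball_le => // u [].
Qed.

Lemma internal_measureE A : ball_family A ->
  internal_measure omega A = ereal_sup (range (vol_ball A)).
Proof. by move=> bA; apply/cvg_lim => //; exact: vol_ball_cvg. Qed.

Lemma vol_ball_le_measure A r : ball_family A ->
  vol_ball A r <= internal_measure omega A.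
Proof.
by move=> bA; rewrite internal_measureE //; apply: ereal_sup_ubound; exists r.
Qed.

Lemma internal_measure_le A c : ball_family A ->
  (forall r, vol_ball A r <= c) -> internal_measure omega A <= c.
Proof.
by move=> bA h; rewrite internal_measureE //; apply: ge_ereal_sup => _ [r _ <-].
Qed.

Lemma internal_measure_ge0 A : ball_family A -> 0 <= internal_measure omega A.
Proof.
by move=> bA; apply: le_trans (vol_ball_le_measure 0 bA); exact: vol_ball_ge0.
Qed.

Lemma le_internal_measure A A' : ball_family A -> ball_family A' ->
  internal omega A `<=` internal omega A' ->
  internal_measure omega A <= internal_measure omega A'.
Proof.
move=> bA bA' AA; apply: internal_measure_le => // r.
by apply: le_trans (vol_ball_le_measure r bA');
  apply: vol_ball_le => // u [/AA].
Qed.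

Lemma ball_family0 : ball_family (fun i => set0 : set (X i)).
Proof. by move=> i; exact: (sig_set0 (@ball_algebra_sigma_algebra _ _)). Qed.

Lemma ball_family_ball r : ball_family (pb r).
Proof. by move=> i; exact: ball_algebra_ball. Qed.

Lemma ball_familyU A A' : ball_family A -> ball_family A' ->
  ball_family (fun i => A i `|` A' i).
Proof. by move=> bA bA' i; apply: (sig_setU (@ball_algebra_sigma_algebra _ _)).
  Qed.

Lemma ball_familyI A A' : ball_family A -> ball_family A' ->
  ball_family (fun i => A i `&` A' i).
Proof. by move=> bA bA' i; apply: (sig_setI (@ball_algebra_sigma_algebra _ _)).
  Qed.

Lemma ball_familyD A A' : ball_family A -> ball_family A' ->
  ball_family (fun i => A i `\` A' i).
Proof. by move=> bA bA' i; apply: (sig_setD (@ball_algebra_sigma_algebra _ _)).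
  Qed.

Lemma internal_measureU A A' : ball_family A -> ball_family A' ->
  (forall i, A i `&` A' i = set0) ->
  internal_measure omega (fun i => A i `|` A' i) =
  internal_measure omega A + internal_measure omega A'.
Proof.
move=> bA bA' AA0; have bU := ball_familyU bA bA'.
apply/cvg_lim => //; rewrite (_ : (fun r => _) = (fun r =>
  vol_ball A r + vol_ball A' r)).
  rewrite !internal_measureE //; apply: cvgeD; try exact: vol_ball_cvg.
  by rewrite ge0_adde_def // inE -internal_measureE // internal_measure_ge0.
apply/funext => r; rewrite /vol_ball -ultra_limD; auto.
congr (lim (_ @ omega)); apply/funext => i.
rewrite setIUl (mo_additive (@borel_sigma_algebra _ _) (pmms_measure_on (X
  i))); auto.
by rewrite setIACA AA0 set0I.
Qed.

End InternalSets.

(** * The Loeb measure *)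

Section LoebMeasure.
Local Open Scope ereal_scope.
Context {R : realType} {omega : set_system nat} {UF : UltraFilter omega}.
Context {X : nat -> pmms R}.
Hypothesis np : nonprincipal omega.
Implicit Types (A C : set_family X) (N B : set (finite_part omega X)).

Local Notation base := (fun i => pmms_point (X i)).
Local Notation m i := (pmms_measure (X i)).
Local Notation pb r := (fun i => ball (pmms_point (X i)) r : set (X i)).
Local Notation im := (internal_measure omega).
Local Notation int := (internal omega).

Lemma internal_measureU_le A A' : ball_family A -> ball_family A' ->
  im (fun i => A i `|` A' i) <= im A + im A'.
Proof.
move=> bA bA'; have bD := ball_familyD bA' bA.
rewrite (_ : (fun i => A i `|` A' i) = (fun i => A i `|` (A' i `\` A i)));
  last first.
  apply: functional_extensionality_dep => i.
  apply/seteqP; split=> x [Ax|]; [by left| |by left|by case; right].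
  by have [|nAx] := pselect (A i x); [left|right].
rewrite internal_measureU //; last by move=> i;
  rewrite setDE setICA setICr setI0.
by rewrite leeD2l // le_internal_measure //; apply: sub_internal => i x [].
Qed.

Lemma internal_measureID A A' : ball_family A -> ball_family A' ->
  im A = im (fun i => A i `&` A' i) + im (fun i => A i `\` A' i).
Proof.
move=> bA bA'; have bI := ball_familyI bA bA'; have bD := ball_familyD bA bA'.
rewrite -internal_measureU //; last first.
  by move=> i; rewrite -subset0 => x [[_ A'x] []].
by congr (im _); apply: functional_extensionality_dep => i; rewrite setUIDK.
Qed.

Lemma internal_measure_ball_lty r : (exists M : R, forall i,
  m i (pb r i) <= M%:E) ->
  im (pb r) < +oo.
Proof.
move=> [M mM]; apply: (@le_lt_trans _ _ M%:E); last exact: ltry.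
apply: (internal_measure_le (ball_family_ball r)) => s.
rewrite -(ultra_lim_cst (omega := omega) M%:E); apply: ultra_lim_le.
- exact: (measure_ballI_ge0 s (@ball_family_ball _ _ r)).
- move=> i; apply: le_trans (mM i).
  by apply: (mo_ge0 (pmms_measure_on (X i))); exact: borel_ball.
- apply: nearW => i; apply: le_trans (mM i).
  apply: (mo_le (@borel_sigma_algebra _ _) (pmms_measure_on (X i))) =>
    [||x []//].
    exact: (ball_family_ballI s (@ball_family_ball _ _ r)).
  exact: borel_ball.
Qed.

(* Countable saturation: in the [i]-th space take [C n i] with [n] as large as
   the first [i] of the bounds on the measures allow. *)
Lemma saturation (C : nat -> set_family X) (L : R) :
  (forall n, ball_family (C n)) -> (forall n i, C n i `<=` C n.+1 i) ->
  (forall n, im (C n) <= L%:E) ->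
  exists D : set_family X,
    [/\ ball_family D, forall n, int (C n) `<=` int D & im D <= L%:E].
Proof.
move=> bC CS CL.
have Cle n k i : (n <= k)%N -> C n i `<=` C k i.
  move=> /subnKC <-; elim: (k - n)%N => [|j ih]; first by rewrite addn0.
  by rewrite addnS; exact: subset_trans ih (CS _ _).
(* The slack [1 / (k + 1)] makes the inequality strict, hence true for [omega]-a.e. [i], and
   vanishes as [k] grows. *)
pose S k : set nat := [set i | m i (C k i `&` pb k%:R i) < (L + k.+1%:R^-1)%:E].
have omS k : omega (S k).
  apply: ultra_lim_lt; first exact: measure_ballI_ge0.
  apply: le_lt_trans (vol_ball_le_measure k%:R (bC k)) _.
  by apply: le_lt_trans (CL k) _; rewrite lte_fin ltrDl invr_gt0 ltr0Sn.
(* The clause [n <= i] bounds the good [n] at a given [i]. When there is any, there is thus a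
   largest one [M], and by monotonicity the union [D i] below is just [C M i]. *)
pose good n i := (n <= i)%N /\ forall k, (k <= n)%N -> S k i.
have omgood n : omega (good n).
  elim: n => [|n ih].
    by apply: filterS (omS 0%N) => i Si; split => // k;
      rewrite leqn0 => /eqP ->.
  apply: filterS3 (@ultra_cofinite _ UF np n.+1) ih (omS n.+1) => i ni [_ g] Si.
  split=> // k.
  by rewrite leq_eqVlt => /orP[/eqP -> //|]; exact: g.
pose D : set_family X := fun i => \bigcup_(n in good^~ i) C n i.
have bD : ball_family D.
  move=> i; apply: (sig_bigcup (@ball_algebra_sigma_algebra _ _)) => // n _.
  exact: bC.
exists D; split=> //.
  by move=> n u un; apply: filterS2 un (omgood n) => i Ci gi; exists n.
apply: internal_measure_le => // r; apply/lee_addgt0Pr => e e0.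
have [k ke] := ltr_add_invr e0; rewrite add0r in ke.
(* From [N >= k] the slack [1 / (M + 1)] is below [e]; from [N > r] the ball of radius [M], on which
   the measure is controlled, contains the one of radius [r]. *)
pose N := maxn k (Num.truncn r).+1.
rewrite -[leRHS](ultra_lim_cst (omega := omega)) -EFinD.
have Le0 : 0 <= (L + e)%:E.
  apply: le_trans (internal_measure_ge0 (bC 0%N)) _.
  by apply: le_trans (CL 0%N) _; rewrite lee_fin lerDl ltW.
apply: ultra_lim_le => //; first exact: measure_ballI_ge0.
apply: filterS (omgood N) => i gN.
have exP : exists n, `[< good n i >] by exists N; apply/asboolP.
have ubP n : `[< good n i >] -> (n <= i)%N by move=> /asboolP[].
have [M /asboolP gM Mmax] := ex_maxnP exP ubP.
have NM : (N <= M)%N by apply: Mmax; apply/asboolP.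
have [_ /(_ M (leqnn M)) SM] := gM.
apply: (@le_trans _ _ (L + M.+1%:R^-1)%:E).
  apply: le_trans (ltW SM); apply: measure_ballI_le => //.
    by move=> x [[n /asboolP gn Cx] _]; exact: Cle (Mmax n gn) _ Cx.
  apply: (@le_trans _ _ (Num.truncn r).+1%:R); first exact/ltW/truncnS_gt.
  by rewrite ler_nat (leq_trans _ NM) // leq_maxr.
rewrite lee_fin lerD2l (le_trans _ (ltW ke)) // lef_pV2 ?posrE ?ltr0Sn //.
by rewrite ler_nat ltnS (leq_trans _ NM) // leq_maxl.
Qed.

Definition partial_union (A : nat -> set_family X) n : set_family X :=
  fun i => \big[setU/set0]_(k < n.+1) A k i.
Arguments partial_union A n : clear implicits.

Lemma partial_union0 (A : nat -> set_family X) : partial_union A 0 = A 0%N.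
Proof.
apply: functional_extensionality_dep => i.
by rewrite /partial_union big_ord_recl big_ord0 setU0.
Qed.

Lemma partial_unionS (A : nat -> set_family X) n :
  partial_union A n.+1 = (fun i => partial_union A n i `|` A n.+1 i) .
Proof.
by apply: functional_extensionality_dep => i;
  rewrite /partial_union big_ord_recr.
Qed.

Lemma ball_family_partial_union (A : nat -> set_family X) n : (forall k,
  ball_family (A k)) ->
  ball_family (partial_union A n).
Proof.
move=> bA i; apply: (@sig_bigsetU _ _ (@ball_algebra_sigma_algebra _ _) (A^~
  i)) => k.
exact: bA.
Qed.

Lemma internal_partial_union (A : nat -> set_family X) n :
  int (partial_union A n) = \bigcup_(k < n.+1) int (A k).
Proof.
elim: n => [|n ih]; first by rewrite partial_union0 bigcup_mkord big_ord_recl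
  big_ord0 setU0.
by rewrite partial_unionS internalU ih !bigcup_mkord [RHS]big_ord_recr.
Qed.

Lemma internal_measure_partial_union_le (A : nat -> set_family X) n :
  (forall k, ball_family (A k)) ->
  im (partial_union A n) <= \sum_(0 <= k < n.+1) im (A k).
Proof.
move=> bA; elim: n => [|n ih]; first by rewrite big_nat1 partial_union0.
have bC := ball_family_partial_union n bA.
rewrite partial_unionS; apply: (le_trans (internal_measureU_le bC (bA _))).
by rewrite [leRHS]big_nat_recr //= leeD2r.
Qed.

Lemma internal_cover (A : nat -> set_family X) (L : R) :
  (forall n, ball_family (A n)) -> (forall n, im (partial_union A n) <= L%:E) ->
  exists D : set_family X,
    [/\ ball_family D, forall n, int (A n) `<=` int D & im D <= L%:E].
Proof.
move=> bA AL; have [|n i|D [bD CD DL]] := saturation _ _ AL.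
- by move=> n; exact: ball_family_partial_union.
- by rewrite partial_unionS; left.
exists D; split=> // n; apply: subset_trans (CD n).
by rewrite internal_partial_union; exact: (@bigcup_sup _ _ n _ _ (ltnSn n)).
Qed.

(** The Loeb outer measure. Null sets are those where it vanishes, and [mbar] agrees with it on
    [ultra_algebra], which removes the choice of approximating families from later arguments. *)
Definition ultra_outer N : \bar R :=
  ereal_inf [set im A | A in [set A | ball_family A /\ N `<=` int A]].

Lemma ultra_outer_cover N A : ball_family A -> N `<=` int A ->
  ultra_outer N <= im A.
Proof. by move=> bA NA; apply: ereal_inf_lbound; exists A. Qed.

Lemma ultra_outer_ge N c :
  (forall A, ball_family A -> N `<=` int A -> c <= im A) -> c <= ultra_outer N.
Proof. by move=> h; apply: le_ereal_inf_tmp => _ [A [bA NA] <-]; exact: h. Qed.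

Lemma ultra_outer_lt N c : ultra_outer N < c ->
  exists A, [/\ ball_family A, N `<=` int A & im A < c].
Proof. by move=> /ereal_inf_lt[_ [A [bA NA] <-] Ac]; exists A. Qed.

Lemma ultra_outer_ge0 N : 0 <= ultra_outer N.
Proof. by apply: ultra_outer_ge => A bA _; exact: internal_measure_ge0. Qed.

Lemma ultra_outer_le N N' : N `<=` N' -> ultra_outer N <= ultra_outer N'.
Proof.
by move=> NN; apply: ultra_outer_ge => A bA NA;
  apply: ultra_outer_cover => // x /NN/NA.
Qed.

Lemma ultra_outer_internal A : ball_family A -> ultra_outer (int A) = im A.
Proof.
move=> bA; apply/le_anti; rewrite ultra_outer_cover //=.
by apply: ultra_outer_ge => A' bA' AA; exact: le_internal_measure.
Qed.

(** A countable union of internal sets is in general not internal; [internal_cover] replaces the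
    union of nearly optimal covers by one internal set obeying the same bound as their partial
    unions. *)
Lemma ultra_outer_bigcup_le (N : nat -> set (finite_part omega X)) :
  ultra_outer (\bigcup_n N n) <= \sum_(0 <= i <oo) ultra_outer (N i).
Proof.
have [fin|] := ltP (\sum_(0 <= i <oo) ultra_outer (N i)) +oo; last first.
  by rewrite leye_eq => /eqP ->; exact: leey.
have s0 : 0 <= \sum_(0 <= i <oo) ultra_outer (N i).
  by apply: nneseries_ge0 => n _ _; exact: ultra_outer_ge0.
apply/lee_addgt0Pr => e e0.
have /choice[A AP] n : exists A, [/\ ball_family A, N n `<=` int A &
    im A <= ultra_outer (N n) + (e / (2 ^ n.+1)%:R)%:E].
  have e2 : (0 < e / (2 ^ n.+1)%:R)%R by rewrite !divr_gt0 // ltr0n expn_gt0.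
  have [|A [bA NA /ltW Al]] :=
      @ultra_outer_lt (N n) (ultra_outer (N n) + (e / (2 ^ n.+1)%:R)%:E).
    rewrite lteDl ?lte_fin // ge0_fin_numE ?ultra_outer_ge0 //.
    apply: le_lt_trans fin.
    apply: le_trans (nneseries_lim_ge n.+1 _); last by move=> *;
      exact: ultra_outer_ge0.
    rewrite big_nat_recr //= leeDr //; apply: sume_ge0 => *;
      exact: ultra_outer_ge0.
  by exists A.
have bA n : ball_family (A n) by have [] := AP n.
have sfin : \sum_(0 <= i <oo) ultra_outer (N i) \is a fin_num by rewrite
  ge0_fin_numE.
have AL n : im (partial_union A n) <=
    (fine (\sum_(0 <= i <oo) ultra_outer (N i)) + e)%:E.
  rewrite EFinD fineK //.
  apply: le_trans (epsilon_trick xpredT (fun n => ultra_outer_ge0 (N n)) (ltW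
    e0)).
  apply: (le_trans (internal_measure_partial_union_le n bA)).
  have ge0 k : 0 <= ultra_outer (N k) + (e / (2 ^ k.+1)%:R)%:E.
    rewrite adde_ge0 ?ultra_outer_ge0 // lee_fin.
    by apply: divr_ge0; [exact: ltW|exact: ler0n].
  apply: le_trans (nneseries_lim_ge n.+1 _); last by move=> k _ _; exact: ge0.
  by apply: lee_sum => k _; have [] := AP k.
have [D [bD AD Dle]] := internal_cover bA AL.
rewrite -(fineK sfin) -EFinD; apply: le_trans Dle;
  apply: ultra_outer_cover => //.
by move=> x [n _ Nx]; apply: (AD n); have [_ NA _] := AP n; exact: NA.
Qed.

Lemma ultra_outer0 : ultra_outer set0 = 0.
Proof.
apply/le_anti; rewrite ultra_outer_ge0 andbT.
apply: le_trans (ultra_outer_cover (@ball_family0 _ _) _) _ => //.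
apply: internal_measure_le => [|r]; first exact: ball_family0.
rewrite -(ultra_lim_cst (omega := omega) 0); apply: ultra_lim_le => //.
  by move=> i; rewrite set0I (mo_set0 (pmms_measure_on (X i))).
by apply: nearW => i; rewrite set0I (mo_set0 (pmms_measure_on (X i))).
Qed.

Lemma ultra_outerU_le N N' :
  ultra_outer (N `|` N') <= ultra_outer N + ultra_outer N'.
Proof.
rewrite -bigcup2E; apply: (le_trans (ultra_outer_bigcup_le _)).
rewrite (nneseries_split 0 2) => [|k _]; last exact: ultra_outer_ge0.
rewrite !big_nat_recr //= big_geq // add0e eseries0 ?adde0 //.
by move=> [|[|n]] //= _ _; exact: ultra_outer0.
Qed.

Lemma ultra_nullP N : ultra_null N <-> ultra_outer N = 0.
Proof.
split=> [nN|N0 e e0]; last by apply: ultra_outer_lt; rewrite N0 lte_fin.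
apply/le_anti; rewrite ultra_outer_ge0 andbT;
  apply/lee_addgt0Pr => e /nN[A [bA NA Ae]].
by rewrite add0e; apply: le_trans (ltW Ae); exact: ultra_outer_cover.
Qed.

Lemma sub_ultra_null N N' : N `<=` N' -> ultra_null N' -> ultra_null N.
Proof.
move=> NN nN' e /nN'[A [bA NA Ae]]; exists A; split=> //;
  exact: subset_trans NA.
Qed.

Lemma ultra_null_bigcup (N : nat -> set (finite_part omega X)) :
  (forall n, ultra_null (N n)) -> ultra_null (\bigcup_n N n).
Proof.
move=> nN; apply/ultra_nullP/le_anti; rewrite ultra_outer_ge0 andbT.
apply: (le_trans (ultra_outer_bigcup_le N)); rewrite eseries0 // => i _ _.
exact/ultra_nullP.
Qed.

Lemma ultra_nullU N N' : ultra_null N -> ultra_null N' -> ultra_null (N `|` N').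
Proof.
move=> /ultra_nullP n /ultra_nullP n'; apply/ultra_nullP/le_anti.
by rewrite ultra_outer_ge0 andbT; apply: (le_trans (ultra_outerU_le _ _));
  rewrite n n' adde0.
Qed.

Lemma ultra_outer_null_le N N' : ultra_null (N `\` N') ->
  ultra_outer N <= ultra_outer N'.
Proof.
move=> /ultra_nullP nD; rewrite -[leRHS]adde0 -nD;
  apply: le_trans (ultra_outerU_le _ _).
apply: ultra_outer_le => x Nx; have [|nN'x] := pselect (N' x);
  [by left|by right].
Qed.

End LoebMeasure.

Arguments partial_union {R X} A n.

(** * Measurable sets and sigma-additivity of the Loeb measure *)

Section LoebAlgebra.
Local Open Scope ereal_scope.
Context {R : realType} {omega : set_system nat} {UF : UltraFilter omega}.
Context {X : nat -> pmms R}.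
Hypothesis np : nonprincipal omega.

Local Notation pb r := (fun i => ball (pmms_point (X i)) r : set (X i)).
Local Notation im := (internal_measure omega).
Local Notation int := (internal omega).
Local Notation outer := (@ultra_outer R omega UF X).

Hypothesis bdd : forall r : R, im (pb r) < +oo.
Implicit Types (A : set_family X) (B : set (finite_part omega X)) (r : R).

(** The right-hand side does not mention [A], so the arbitrary choice made by [xget] in [mbar] is
    harmless. *)
Lemma approximates_measure B r A : approximates B r A ->
  im A = outer (B `&` int (pb r)).
Proof.
move=> [bA nA]; rewrite -ultra_outer_internal //; apply/le_anti/andP; split.
  by apply: (ultra_outer_null_le np); apply: sub_ultra_null nA => x; right.
by apply: (ultra_outer_null_le np); apply: sub_ultra_null nA => x; left.
Qed.

Lemma ultra_null0 : ultra_null (set0 : set (finite_part omega X)).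
Proof. by apply/ultra_nullP; exact: ultra_outer0. Qed.

Lemma ultra_algebra_internal A : ball_family A -> ultra_algebra omega X (int A).
Proof.
move=> bA r r0; exists (fun i => A i `&` pb r i); split.
  by apply: ball_familyI => //; exact: ball_family_ball.
by rewrite internalI setYK; exact: ultra_null0.
Qed.

Lemma ultra_algebraC B : ultra_algebra omega X B ->
  ultra_algebra omega X (~` B).
Proof.
move=> mB r r0; have [A [bA nA]] := mB r r0; exists (fun i => pb r i `\` A i);
  split.
  by apply: ball_familyD => //; exact: ball_family_ball.
apply: sub_ultra_null nA; rewrite internalD => x [[[nBx bx] nD]|[[bx nAx] nB]].
  right; split; last by case.
  by apply: contrapT => nAx; exact: nD.
by left; split => //; split=> //; apply: contrapT => nBx; exact: nB.
Qed.

(** Truncated to the ball, the partial unions [C n] increase and their measures have a finite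
    supremum. Saturation gives an internal [D] above all of them with measure at most that supremum,
    so [D] without [C n] has measure tending to zero and [D] exceeds the union by a null set
    only. *)
Lemma ultra_algebra_bigcup (B : nat -> set (finite_part omega X)) :
  (forall n, ultra_algebra omega X (B n)) -> ultra_algebra omega X (\bigcup_n B
    n).
Proof.
move=> mB r r0; have /choice[A AP] n : exists A, approximates (B n) r A by
  exact: mB.
pose A' n : set_family X := fun i => A n i `&` pb r i.
have bA' n : ball_family (A' n).
  by have [bA _] := AP n; apply: ball_familyI => //; exact: ball_family_ball.
pose C := partial_union A'; have bC n : ball_family (C n).
  exact: ball_family_partial_union.
have Cr n : int (C n) `<=` int (pb r).
  by rewrite internal_partial_union => x [k _]; rewrite internalI => -[].
have CL n : im (C n) <= ereal_sup (range (im \o C)).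
  by apply: ereal_sup_ubound; exists n.
have Lfin : ereal_sup (range (im \o C)) \is a fin_num.
  rewrite ge0_fin_numE; last by apply: le_trans (CL 0%N);
    exact: internal_measure_ge0.
  apply: le_lt_trans (bdd r); apply: ge_ereal_sup => _ [n _ <-] /=.
  by apply: le_internal_measure => //; exact: ball_family_ball.
have [|D [bD AD DL]] := @internal_cover _ _ _ _ np A' (fine (ereal_sup (range
  (im \o C)))) bA'.
  by move=> n; rewrite fineK //; exact: CL.
exists D; split=> //.
have CD n : int (C n) `<=` int D.
  by rewrite internal_partial_union => x [k _]; exact: AD.
have nD : ultra_null (int D `\` \bigcup_n int (C n)).
  move=> e e0; have [_ [n _ <-] /= nL] := ub_ereal_sup_adherent e0 Lfin.
  exists (fun i => D i `\` C n i); split.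
  - exact: ball_familyD.
  - by rewrite internalD => x [Dx nC]; split=> // Cx; apply: nC; exists n.
  - have := internal_measureID bD (bC n).
    have : im (C n) <= im (fun i => D i `&` C n i).
      apply: le_internal_measure => //; first exact: ball_familyI.
      by rewrite internalI => x Cx; split=> //; exact: (CD n _ Cx).
    have bDC := ball_familyD bD (bC n).
    move=> le1 imD; have : im (C n) + im (fun i => D i `\` C n i) <=
        (fine (ereal_sup (range (im \o C))))%:E.
      by apply: le_trans DL; rewrite imD leeD2r.
    have := @internal_measure_ge0 R omega UF X _ bDC.
    have := @internal_measure_ge0 R omega UF X _ (bC n).
    move: nL; rewrite -{1}(fineK Lfin) -EFinB.
    move: (im (C n)) (im (fun i => D i `\` C n i)) => [c| |] [q| |] //=.
      by rewrite -EFinD !lte_fin !lee_fin; lra.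
apply: sub_ultra_null (ultra_nullU np (ultra_null_bigcup np (fun n =>
  (AP n).2)) nD).
move=> x [[[[n _ Bx] bx] nDx]|[Dx nB]].
  left; exists n => //; left; split=> // Ax; apply: nDx; apply: (AD n).
  by rewrite internalI.
have [[n _]|nC] := pselect ((\bigcup_n int (C n)) x); last by right.
rewrite internal_partial_union => -[k _]; rewrite internalI => -[Ax bx].
left; exists k => //; right; split=> // -[Bx _]; apply: nB; split=> //.
by exists k.
Qed.

Lemma ultra_algebra_sigma_algebra : sigma_algebra setT (ultra_algebra omega X).
Proof.
split; last exact: ultra_algebra_bigcup.
- have := ultra_algebra_internal (@ball_family0 R X).
  rewrite (_ : int _ = set0) // -subset0 => x h.
  by have [] := filter_ex h.
- by move=> B; rewrite setTD; exact: ultra_algebraC.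
Qed.

(** The point is to cover an unbounded [B] by one internal set without exceeding the supremum over
    balls. Approximating families at the radii [n + 1] cover [B] up to a null set, their partial
    unions stay below the supremum, and saturation merges them. *)
Lemma ultra_outer_exhaust B : ultra_algebra omega X B ->
  outer B = ereal_sup (range (fun r => outer (B `&` int (pb r)))).
Proof.
move=> mB; set L := ereal_sup _; apply/le_anti/andP; split; last first.
  by apply: ge_ereal_sup => _ [r _ <-]; apply: ultra_outer_le => x [].
have [Loo|] := ltP L +oo; last by rewrite leye_eq => /eqP ->; exact: leey.
have LP r : outer (B `&` int (pb r)) <= L by apply: ereal_sup_ubound; exists r.
have Lfin : L \is a fin_num.
  by rewrite ge0_fin_numE // (le_trans _ (LP 0%R)) // ultra_outer_ge0.
have /choice[A AP] n : exists A, approximates B n.+1%:R A by apply: mB;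
  rewrite ltr0Sn.
have bA n : ball_family (A n) by have [] := AP n.
have [|D [bD AD DL]] := @internal_cover _ _ _ _ np A (fine L) bA.
  move=> n; rewrite fineK // -ultra_outer_internal;
    last exact: ball_family_partial_union.
  apply: le_trans (LP n.+1%:R); apply: (ultra_outer_null_le np).
  apply: sub_ultra_null (ultra_null_bigcup np (fun n => (AP n).2)).
  rewrite internal_partial_union => x [[k /= kn Ax] nB]; exists k => //; right.
  split=> // -[Bx bx]; apply: nB; split=> //; apply: sub_internal bx => i.
  by apply: le_ball; rewrite ler_nat.
rewrite -(fineK Lfin); apply: le_trans DL; rewrite -ultra_outer_internal //.
apply: (ultra_outer_null_le np).
apply: sub_ultra_null (ultra_null_bigcup np (fun n => (AP n).2)) => x [Bx nDx].
have [n bx] := internal_ball_exhaust x; exists n => //; left; split.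
  by split=> //; apply: sub_internal bx => i; apply: le_ball; rewrite ler_nat.
by move=> /AD.
Qed.

Lemma mbarE B : ultra_algebra omega X B -> mbar B = outer B.
Proof.
move=> mB; rewrite ultra_outer_exhaust //; apply/cvg_lim => //.
apply: cvg_trans (nondecreasing_cvge _); last first.
  move=> r r' rr; apply: ultra_outer_le => x [Bx bx]; split=> //.
  by apply: sub_internal bx => i; exact: le_ball.
apply: near_eq_cvg; near=> r.
have r0 : (0 < r)%R by near: r; exact: nbhs_pinfty_gt.
have [A AP] := mB r r0.
by rewrite (approximates_measure (xgetPex _ (ex_intro _ A AP))).
Unshelve. all: by end_near. Qed.

(** Inside a ball, disjoint measurable sets are approximated by families whose intersection is null,
    so additivity comes from [internal_measure]; the radius then tends to infinity. *)
Lemma ultra_outerU B B' : ultra_algebra omega X B -> ultra_algebra omega X B' ->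
  B `&` B' = set0 -> outer (B `|` B') = outer B + outer B'.
Proof.
move=> mB mB' BB; apply/le_anti; rewrite ultra_outerU_le //=.
have add (r : R) : (0 < r)%R -> outer (B `&` int (pb r)) + outer (B' `&` int
  (pb r)) <=
    outer (B `|` B').
  move=> r0; have [A AP] := mB r r0; have [A' AP'] := mB' r r0.
  rewrite -(approximates_measure AP) -(approximates_measure AP').
  have [[bA nA] [bA' nA']] := (AP, AP').
  have bI := ball_familyI bA bA'.
  have nI : im (fun i => A i `&` A' i) = 0.
    rewrite -ultra_outer_internal //; apply/ultra_nullP.
    apply: sub_ultra_null (ultra_nullU np nA nA');
      rewrite internalI => x [Ax A'x].
    have [Bx|nBx] := pselect (B x); last by left; right; split=> // -[].
    right; right; split=> // -[B'x _].
    by have : (B `&` B') x by []; rewrite BB.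
  rewrite (internal_measureID bA bA') nI add0e -internal_measureU //;
    last 2 first.
  - exact: ball_familyD.
  - by move=> i; rewrite -subset0 => x [[_ nA'x]].
  rewrite -ultra_outer_internal; last by apply: ball_familyU => //;
    exact: ball_familyD.
  apply: (ultra_outer_null_le np); apply: sub_ultra_null (ultra_nullU np nA
    nA').
  rewrite internalU internalD => x [[[Ax _]|A'x] nBB].
    by left; right; split=> // -[Bx _]; apply: nBB; left.
  by right; right; split=> // -[Bx _]; apply: nBB; right.
have lim_outer C : ultra_algebra omega X C ->
    outer (C `&` int (pb r)) @[r --> +oo%R] --> outer C.
  move=> mC; rewrite ultra_outer_exhaust //;
    apply: nondecreasing_cvge => r r' rr.
  apply: ultra_outer_le => x [Bx bx]; split=> //.
  by apply: sub_internal bx => i; exact: le_ball.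
apply: (cvge_to_le (cvgeD _ (lim_outer _ mB) (lim_outer _ mB'))).
  by rewrite ge0_adde_def // inE ultra_outer_ge0.
by near=> r; apply: add; near: r; exact: nbhs_pinfty_gt.
Unshelve. all: by end_near. Qed.

(** Finite additivity bounds the partial sums by the measure of the union; countable subadditivity
    of the outer measure is the converse inequality. *)
Lemma mbar_measure_on : measure_on (ultra_algebra omega X) (@mbar R omega UF X).
Proof.
have sU := ultra_algebra_sigma_algebra; split=> [|B mB|F mF tF].
- by rewrite mbarE ?ultra_outer0 //; exact: sig_set0.
- by rewrite mbarE // ultra_outer_ge0.
have mS : ultra_algebra omega X (\bigcup_n F n) by exact: sig_bigcupT.
have mSn n : ultra_algebra omega X (\big[setU/set0]_(k < n) F k) by exact:
  sig_bigsetU.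
have outer_sum n : \sum_(0 <= i < n) outer (F i) = outer (\big[setU/set0]_(k <
  n) F k).
  elim: n => [|n ih]; first by rewrite big_geq // big_ord0 ultra_outer0.
  rewrite big_nat_recr //= ih big_ord_recr ultra_outerU //.
  rewrite -bigcup_mkord -subset0 => x [[k /= kn Fk] Fn].
  have kE : k = n by apply: tF => //; exists x.
  by move: kn; rewrite kE ltnn.
have le_sum n : \sum_(0 <= i < n) outer (F i) <= outer (\bigcup_n F n).
  rewrite outer_sum; apply: ultra_outer_le; rewrite -bigcup_mkord.
  by move=> x [k _ Fx]; exists k.
rewrite (_ : (fun n => _) = (fun n => \sum_(0 <= i < n) outer (F i)));
  last first.
  by apply/funext => n; apply: eq_bigr => i _; rewrite mbarE.
have cF : cvgn (fun n => \sum_(0 <= i < n) outer (F i)).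
  by apply: is_cvg_nneseries => i _ _; exact: ultra_outer_ge0.
rewrite mbarE // (_ : outer _ = \sum_(0 <= i <oo) outer (F i)) //.
apply/le_anti; rewrite (ultra_outer_bigcup_le np) /=.
by apply: lime_le => //; exact: nearW.
Qed.

End LoebAlgebra.

(** * The ultralimit measure *)

Section UltralimitMeasure.
Local Open Scope ereal_scope.
Context {R : realType} {omega : set_system nat} {UF : UltraFilter omega}.
Context {X : nat -> pmms R}.
Implicit Types (A : set_family X) (a b : ultralimit omega X) (x y :
  Defs.family X) (r : R).

Local Notation base := (fun i => pmms_point (X i)).
Local Notation pb r := (fun i => ball (pmms_point (X i)) r : set (X i)).
Local Notation im := (internal_measure omega).
Local Notation int := (internal omega).
Local Notation proj := (@ultra_proj R omega UF X).
Local Notation mu := (ultra_measure omega X).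

Lemma represents_ex x : fdist omega x base < +oo ->
  exists a : ultralimit omega X, represents a x.
Proof. by move=> /finite_part_ex[u ux]; exists (ultra_proj u), u. Qed.

Lemma ultra_proj_surj a : exists u, ultra_proj u = a.
Proof. by exists (repr a); exact: reprK. Qed.

Lemma ultra_proj_represents (u : finite_part omega X) :
  represents (ultra_proj u) (repr (val u)).
Proof. by exists u => //; rewrite reprK. Qed.

Lemma representsP a : exists x, represents a x.
Proof.
have [u <-] := ultra_proj_surj a.
by exists (repr (val u)); exact: ultra_proj_represents.
Qed.

Lemma represents_point : represents (ultra_point omega X) base.
Proof. by eexists; last reflexivity. Qed.

Lemma represents_dist a b x y : represents a x -> represents b y ->
  (mdist a b)%:E = fdist omega x y.
Proof.
move=> [u ux <-] [v vy <-]; rewrite ultra_projE fineK ?dbar_fin //.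
by rewrite ux vy dbarE.
Qed.

Lemma represents_lt a b x y r : represents a x -> represents b y ->
  (mdist a b < r)%R -> \forall i \near omega, (mdist (x i) (y i) < r)%R.
Proof. by move=> ax yb; rewrite -lte_fin (represents_dist ax yb) =>
  /fdist_lt. Qed.

Lemma represents_le a b x y r : represents a x -> represents b y ->
  (\forall i \near omega, (mdist (x i) (y i) <= r)%R) -> (mdist a b <= r)%R.
Proof. by move=> ax yb h; rewrite -lee_fin (represents_dist ax yb) fdist_le.
  Qed.

Lemma represents_fin a x : represents a x -> fdist omega x base < +oo.
Proof. by move=> ax; rewrite -(represents_dist ax represents_point) ltry. Qed.

Lemma proj_ball_sub_internal a x r : represents a x ->
  proj @^-1` ball a r `<=` int (fun i => ball (x i) r).
Proof.
move=> ax u /ball_mdist au; rewrite /internal /=.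
have := represents_lt ax (ultra_proj_represents u) au.
by apply: filterS => i ?; apply/ball_mdist.
Qed.

(** Coordinate distances below [s] have a limit that may equal [s], whence the larger radius [r]. *)
Lemma internal_sub_proj_ball a x r s : represents a x -> (s < r)%R ->
  int (fun i => ball (x i) s) `<=` proj @^-1` ball a r.
Proof.
move=> ax sr u us; apply/ball_mdist; apply: le_lt_trans sr.
apply: (represents_le ax (ultra_proj_represents u)).
by apply: filterS us => i /ball_mdist /ltW.
Qed.

Hypothesis np : nonprincipal omega.
Hypothesis bdd : forall r : R, im (pb r) < +oo.

Let sU := ultra_algebra_sigma_algebra np bdd.
Let mm := @mbar_measure_on R omega UF X np bdd.
Let sG := @ball_algebra_sigma_algebra R (ultralimit omega X).

Lemma ultra_algebra_proj_ball a r : ultra_algebra omega X (proj @^-1` ball a r).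
Proof.
have [x ax] := representsP a.
have -> : proj @^-1` ball a r =
    \bigcup_n int (fun i => ball (x i) (r - n.+1%:R^-1)%R).
  apply/seteqP; split=> u; last first.
    by move=> [n _]; apply: internal_sub_proj_ball => //;
      rewrite ltrBlDr ltrDl invr_gt0 ltr0Sn.
  move=> /ball_mdist /ltr_add_invr[n an]; exists n => //.
  apply: (proj_ball_sub_internal ax); apply/ball_mdist.
  by rewrite ltrBrDr.
apply: (sig_bigcupT sU) => n; apply: ultra_algebra_internal => i.
exact: ball_algebra_ball.
Qed.

Lemma ultra_algebra_proj E : ball_algebra E -> ultra_algebra omega X (proj
  @^-1` E).
Proof.
pose G := [set E : set (ultralimit omega X) | ultra_algebra omega X (proj @^-1`
  E)].
suff : @ball_algebra R (ultralimit omega X) `<=` G by apply.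
apply: smallest_sub; last by move=> _ [a [r ->]];
  exact: ultra_algebra_proj_ball.
split=> [|A GA|F GF].
- by rewrite /G /= preimage_set0; exact: sig_set0 sU.
- by rewrite /G /= setTD preimage_setC; exact: (sig_setC sU).
- by rewrite /G /= preimage_bigcup; exact: (sig_bigcupT sU).
Qed.

Lemma ultralimit_existsP : ultralimit_exists omega X.
Proof.
split; [exact: sU|exact: mbar_measure_on|exact: ultra_algebra_proj].
Qed.

Lemma ultra_measure_on : measure_on (@ball_algebra R (ultralimit omega X)) mu.
Proof.
split=> [|E GE|F GF tF].
- by rewrite /ultra_measure preimage_set0 (mo_set0 mm).
- by apply: (mo_ge0 mm); exact: ultra_algebra_proj.
rewrite /ultra_measure preimage_bigcup; case: mm => _ _; apply.
  by move=> n; exact: ultra_algebra_proj.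
move=> i j _ _ [u [ui uj]]; apply: tF => //; by exists (ultra_proj u).
Qed.

Lemma ultra_measureE E : ball_algebra E ->
  mu E = ultra_outer (proj @^-1` E).
Proof. by move=> GE; rewrite -(mbarE np) //; exact: ultra_algebra_proj. Qed.

Lemma ultra_measure_le E A : ball_algebra E -> ball_family A ->
  proj @^-1` E `<=` int A -> mu E <= im A.
Proof.
by move=> GE bA EA; rewrite ultra_measureE // -ultra_outer_internal //
  ultra_outer_le.
Qed.

Lemma ultra_measure_ge E A : ball_algebra E -> ball_family A ->
  int A `<=` proj @^-1` E -> im A <= mu E.
Proof.
by move=> GE bA EA; rewrite ultra_measureE // -ultra_outer_internal //
  ultra_outer_le.
Qed.

(** Bounds [mu E] from below when no single internal set of measure at least [c] is at hand inside
    the preimage. The common ball of radius [r] supplies the finiteness that continuity from above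
    requires. *)
Lemma ultra_measure_bigcap_ge E (A : nat -> set_family X) (c : \bar R) r :
  ball_algebra E -> (forall n, ball_family (A n)) ->
  (forall n i, A n.+1 i `<=` A n i) -> (forall i, A 0%N i `<=` pb r i) ->
  (forall n, c <= im (A n)) ->
  \bigcap_n int (A n) `<=` proj @^-1` E -> c <= mu E.
Proof.
move=> GE bA AS A0 cA AE.
have mA n : ultra_algebra omega X (int (A n)) by exact: ultra_algebra_internal.
have mbA n : mbar (int (A n)) = im (A n) by rewrite (mbarE np) //
  ultra_outer_internal.
apply: (@le_trans _ _ (mbar (\bigcap_n int (A n)))).
  apply: (mo_nonincreasing_ge sU mm) => // [||n].
  - apply/nonincreasing_seqP => n; apply/subsetPset; apply: sub_internal => i.
    exact: AS.
  - rewrite mbA; apply: le_lt_trans (bdd r); apply: le_internal_measure => //.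
      exact: ball_family_ball.
    exact: sub_internal.
  - by rewrite mbA.
apply: (mo_le sU mm) => //; last exact: ultra_algebra_proj.
exact: (sig_bigcapT sU).
Qed.

Lemma ultra_measure_ball_lty a r : mu (ball a r) < +oo.
Proof.
have : ball a r `<=` ball (ultra_point omega X) (mdist (ultra_point omega X) a
  + r)%R.
  exact: ball_sub_ball.
set s := (_ + r)%R => ars; apply: le_lt_trans (bdd s).
apply: ultra_measure_le; [exact: ball_algebra_ball|exact: ball_family_ball|].
apply: subset_trans (proj_ball_sub_internal (represents_point)).
exact: preimage_subset.
Qed.

Lemma spt_ultra_measure_closed : closed (spt mu).
Proof. apply: (spt_closed sG ultra_measure_on) => x r;
  exact: ball_algebra_ball. Qed.

Lemma spt_ultra_measure_approximated :
  exists2 D, countable D & approximated_by D (spt mu).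
Proof.
apply: (spt_approximated sG ultra_measure_on) => [x r|];
  first exact: ball_algebra_ball.
exact: ultra_measure_ball_lty.
Qed.

End UltralimitMeasure.

(** * The limit space *)

Section MetricSubspaces.
Context {R : realType} {T : metricType R}.
Implicit Types (A U : set T) (x y : T).

Lemma mdist_sub A (a b : A) : mdist a b = mdist (set_val a) (set_val b).
Proof. by []. Qed.

Lemma eq_of_mdist_le x y : (forall e : R, 0 < e -> mdist x y <= e) -> x = y.
Proof.
move=> h; apply: mdist_positivity; apply/le_anti; rewrite mdist_ge0 andbT.
by apply/ler_addgt0Pr => e /h; rewrite add0r.
Qed.

Lemma complete_closed A : complete_space A -> closed A.
Proof.
move=> cA; apply/closed_mdistP => x h.
(* The trace on [A] of the neighbourhoods of [x]: proper because [x] is a limit of points of [A],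
   and Cauchy. Its limit in [A] can only be [x]. *)
pose F : set_system A := [set S | exists2 e : R, 0 < e &
  forall a : A, mdist x (set_val a) < e -> S a].
have FP : ProperFilter F.
  split; first by move=> [e e0 eF]; have [y Ay xy] := h _ e0;
    apply: (eF (exist _ y (mem_set Ay))).
  split=> [|S S' [e e0 eS] [e' e'0 eS']|S S' SS [e e0 eS]].
  - by exists 1.
  - exists (Num.min e e'); first by rewrite lt_min e0.
    by move=> a; rewrite lt_min => /andP[/eS ? /eS' ?].
  - by exists e => // a /eS/SS.
have [|l Fl] := cA F FP.
  apply/cauchyP => e e0; have e20 : 0 < e / 2 by rewrite divr_gt0.
  have [y Ay xy] := h _ e20; exists (exist _ y (mem_set Ay));
    exists (e / 2) => // a xa.
  apply/ball_mdist; rewrite mdist_sub (le_lt_trans (metric_triangle _ x _)) //.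
  by rewrite [ltRHS]splitr ltrD // metric_sym.
suff -> : x = set_val l by exact: set_valP.
apply: eq_of_mdist_le => e e0; have e20 : 0 < e / 2 by rewrite divr_gt0.
have [e' e'0 e'l] : F (ball l (e / 2)) by apply: Fl; exact: nbhsx_ballx.
have [|y Ay] := h (Num.min e' (e / 2)); first by rewrite lt_min e'0.
rewrite lt_min => /andP[/(e'l (exist _ y (mem_set Ay)))/ball_mdist ly xy].
rewrite (le_trans (metric_triangle _ y _)) // [leRHS]splitr lerD // ltW //.
by rewrite metric_sym.
Qed.

(** Open sets of a separable [A] are countable unions of balls of [A], which are traces of balls of
    [T]; hence Borel sets of [A] are measurable in [T] even when [T] is not separable. *)
Lemma borel_image_ball_algebra A : ball_algebra A -> separable_space A ->
  forall B : set A, borel B -> ball_algebra (set_val @` B).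
Proof.
move=> GA sA; have sG := @ball_algebra_sigma_algebra R T.
pose G := [set B : set A | ball_algebra (set_val @` B)].
suff : @borel A `<=` G by [].
apply: smallest_sub; last first.
  move=> U oU; have [J [cJ UJ]] := separable_open_ball_algebra sA oU.
  rewrite /G /= UJ image_bigcup; apply: (sig_bigcup sG) => // j _.
  rewrite (_ : _ @` _ = ball (set_val j.1) j.2.+1%:R^-1 `&` A).
    by apply: (sig_setI sG) => //; exact: ball_algebra_ball.
  apply/seteqP; split=> [_ [a /ball_mdist ja <-]|x [/ball_mdist jx Ax]].
    by split; [apply/ball_mdist|exact: set_valP].
  by exists (exist _ x (mem_set Ax)) => //; apply/ball_mdist.
split=> [|B GB|F GF].
- by rewrite /G /= image_set0; exact: (sig_set0 sG).
- rewrite /G /= setTD (_ : _ @` _ = A `\` set_val @` B);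
    first exact: (sig_setD sG).
  apply/seteqP; split=> [_ [a nBa <-]|x [Ax nBx]].
    by split; [exact: set_valP|move=> [b Bb /val_inj ba]; apply: nBa;
      rewrite -ba].
  by exists (exist _ x (mem_set Ax)) => // Bx; apply: nBx;
    exists (exist _ x (mem_set Ax)).
- by rewrite /G /= image_bigcup; exact: (sig_bigcupT sG).
Qed.

End MetricSubspaces.

(** * Morphisms, balls and supports *)

Section Morphisms.
Local Open Scope ereal_scope.
Context {R : realType} {X Y : pmms R} {phi : X -> Y}.
Hypothesis mphi : morphism phi.

Lemma morphism_measure_le A B : borel A -> borel B ->
  (forall x, spt (pmms_measure X) x -> A x -> B (phi x)) ->
  pmms_measure X A <= pmms_measure Y B.
Proof.
have [bphi _ _ mle] := mphi; move=> bA bB AB; apply: le_trans (mle _ bB).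
by apply: pmms_measure_le => //; [exact: bphi|move=> x [Ax sx]; exact: AB].
Qed.

Lemma morphism_ball_le x (r : R) : spt (pmms_measure X) x ->
  pmms_measure X (ball x r) <= pmms_measure Y (ball (phi x) r).
Proof.
have [_ _ lip _] := mphi; move=> sx; apply: morphism_measure_le =>
  [||y sy /ball_mdist xy].
- exact: borel_ball.
- exact: borel_ball.
- by apply/ball_mdist; exact: le_lt_trans (lip _ _ sx sy) xy.
Qed.

Lemma morphism_spt x : spt (pmms_measure X) x -> spt (pmms_measure Y) (phi x).
Proof. by move=> sx r r0; apply: lt_le_trans (sx r r0) (morphism_ball_le _ sx).
  Qed.

Lemma morphism_ball_point_le (r : R) :
  pmms_measure X (ball (pmms_point X) r) <= pmms_measure Y (ball (pmms_point Y)
    r).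
Proof.
have [_ <- _ _] := mphi; apply: morphism_ball_le; exact: pmms_point_spt.
Qed.

End Morphisms.

(** * Threads and the Polish structure of the limit space *)

Section Threads.
Local Open Scope ereal_scope.
Context {R : realType} {omega : set_system nat} {UF : UltraFilter omega}.
Context {X : nat -> pmms R} {P : forall i j, X j -> X i}.
Hypotheses (np : nonprincipal omega) (sysP : inverse_system P).

Local Notation base := (fun i => pmms_point (X i)).
Local Notation m i := (pmms_measure (X i)).
Local Notation L := (limit_space omega P).
Local Notation mu := (ultra_measure omega X).
Local Notation proj := (limit_proj omega P).

Lemma inverse_system_morphism i j : (i <= j)%N -> morphism (@P i j).
Proof. by case: sysP => h _ _; exact: h. Qed.

Lemma inverse_system_bounded (r : R) : exists M : R,
  forall i, m i (ball (pmms_point (X i)) r) <= M%:E.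
Proof.
exists (fine (m 0%N (ball (pmms_point (X 0%N)) r))) => i.
rewrite fineK; last first.
  rewrite ge0_fin_numE ?pmms_ball_lty // (mo_ge0 (pmms_measure_on _)) //.
  exact: borel_ball.
exact/morphism_ball_point_le/inverse_system_morphism.
Qed.

Lemma inverse_system_ubf : uniformly_boundedly_finite X.
Proof.
move=> r _; have [M mM] := inverse_system_bounded r.
by apply: (@le_lt_trans _ _ M%:E); [apply: ge_ereal_sup => _ [i _ <-]|exact:
  ltry].
Qed.

Let bdd r := @internal_measure_ball_lty R omega UF X r (inverse_system_bounded
  r).
Let mm := @ultra_measure_on R omega UF X np bdd.
Let sG := @ball_algebra_sigma_algebra R (ultralimit omega X).

Lemma thread_dist_le x y i j : thread P x -> thread P y -> (i <= j)%N ->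
  (mdist (x i) (y i) <= mdist (x j) (y j))%R.
Proof.
move=> [sx Px] [sy Py] ij; rewrite -(Px i j ij) -(Py i j ij).
by have [_ _ lip _] := inverse_system_morphism ij; exact: lip.
Qed.

Lemma thread_dist_le_fdist x y i : thread P x -> thread P y ->
  (mdist (x i) (y i))%:E <= fdist omega x y.
Proof.
move=> tx ty; apply: (cvge_to_ge (@fdist_cvg _ _ UF _ x y)).
apply: filterS (@ultra_cofinite _ UF np i) => j ij.
by rewrite lee_fin thread_dist_le.
Qed.

Lemma fdist_le_of_all (x y : Defs.family X) (e : R) : (forall i,
  (mdist (x i) (y i) <= e)%R) ->
  fdist omega x y <= e%:E.
Proof. by move=> h; apply: fdist_le; exact: nearW. Qed.

Lemma represents_thread_dist_le (a b : ultralimit omega X) x y i :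
  represents a x -> represents b y -> thread P x -> thread P y ->
  (mdist (x i) (y i) <= mdist a b)%R.
Proof.
move=> ax yb tx ty; rewrite -lee_fin (represents_dist ax yb).
exact: thread_dist_le_fdist.
Qed.

Lemma represents_thread_inj (a : ultralimit omega X) x y :
  represents a x -> represents a y -> thread P x -> thread P y -> forall i,
    x i = y i.
Proof.
move=> ax ay tx ty i; apply: mdist_positivity; apply/le_anti.
by rewrite mdist_ge0 andbT -(mdistxx a) represents_thread_dist_le.
Qed.

Lemma limit_projP (a : L) :
  represents (set_val a) (proj^~ a) /\ thread P (proj^~ a).
Proof.
have [[x ax tx] _] := set_valP a.
apply: (@xgetPex _ (base : Defs.family X)
  [set x | represents (set_val a) x /\ thread P x]).
by exists x.
Qed.

Lemma limit_proj_eq (a : L) x : represents (set_val a) x -> thread P x ->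
  forall i, proj i a = x i.
Proof. by move=> ax tx; have [aa ta] := limit_projP a;
  exact: represents_thread_inj aa ax ta tx. Qed.

Lemma limit_proj_spt i a : spt (m i) (proj i a).
Proof. by have [_ [h _]] := limit_projP a; exact: h. Qed.

Lemma limit_proj_compat i j a : (i <= j)%N -> P i (proj j a) = proj i a.
Proof. by have [_ [_ h]] := limit_projP a; exact: h. Qed.

Lemma limit_proj_lip i (a b : L) : (mdist (proj i a) (proj i b) <= mdist a b)%R.
Proof.
have [aa ta] := limit_projP a; have [bb tb] := limit_projP b.
exact: represents_thread_dist_le aa bb ta tb.
Qed.

(** Each coordinate of a Cauchy filter converges, since the projections are 1-Lipschitz and [X i] is
    complete. Coordinate bounds that are uniform in [i] become bounds on the ultralimit distance, so
    the family [y] of coordinate limits represents the limit point. *)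
Lemma limit_space_complete : complete_space L.
Proof.
move=> F FF /cauchyP Fc.
have Fproj i : cauchy (proj i @ F).
  apply: cauchy_exP => e e0; have [c Fce] := Fc e e0; exists (proj i c).
  change (F (proj i @^-1` ball (proj i c) e)).
  apply: filterS Fce => b /ball_mdist cb; apply/ball_mdist.
  exact: le_lt_trans (limit_proj_lip i c b) cb.
have yP i : {l : X i | proj i @ F --> l}.
  by apply: cid; apply: (@pmms_complete _ (X i)) => //;
    exact: fmap_proper_filter.
pose y : Defs.family X := fun i => sval (yP i).
(* Passing to the limit within [ball c e] loses the strict inequality but keeps the same bound [e]
   for all [i]. *)
have near_y c (e : R) : F (ball c e) -> forall i, (mdist (proj i c) (y i) <=
  e)%R.
  move=> Fce i; apply/ler_addgt0Pr => d d0.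
  have : F (proj i @^-1` ball (y i) d).
    exact: (svalP (yP i) (ball (y i) d) (nbhsx_ballx _ _ d0)).
  move=> /(filterI Fce)/filter_ex[b [/ball_mdist cb /ball_mdist yb]].
  rewrite (le_trans (metric_triangle _ (proj i b) _)) // lerD //.
    exact/ltW/(le_lt_trans (limit_proj_lip i c b)).
  by rewrite metric_sym ltW.
have ty : thread P y.
  have sy i : spt (m i) (y i).
    apply: ((closed_mdistP _).1 (@pmms_spt_closed _ (X i))) => e e0.
    have e20 : (0 < e / 2)%R by rewrite divr_gt0.
    have [c /near_y/(_ i) cy] := Fc _ e20; exists (proj i c);
      first exact: limit_proj_spt.
    by rewrite metric_sym (le_lt_trans cy) // ltr_pdivrMr // ltr_pMr // ltr1n.
  split=> // i j ij; apply: eq_of_mdist_le => e e0.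
  have e20 : (0 < e / 2)%R by rewrite divr_gt0.
  have [c /near_y cy] := Fc _ e20; have [_ _ lip _] := inverse_system_morphism
    ij.
  rewrite (le_trans (metric_triangle _ (proj i c) _)) // [leRHS]splitr lerD //.
  rewrite -(limit_proj_compat c ij) metric_sym (le_trans (lip _ _ _ _)) //.
  exact: limit_proj_spt.
have [c1 /near_y c1y] := Fc 1%R ltr01.
have [|b yb] := @represents_ex _ omega UF X y.
  apply: (le_lt_trans (fdist_triangle (proj^~ c1) _ _)).
  have [cc _] := limit_projP c1; apply: lte_add_pinfty;
    last exact: represents_fin cc.
  by apply: le_lt_trans (ltry 1%R); apply: fdist_le_of_all => i;
    rewrite metric_sym.
have bc c (e : R) : F (ball c e) -> (mdist b (set_val c) <= e)%R.
  move=> /near_y cy; have [cc _] := limit_projP c.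
  rewrite metric_sym -lee_fin (represents_dist cc yb); exact: fdist_le_of_all.
have sb : spt mu b.
  apply: ((closed_mdistP _).1 (spt_ultra_measure_closed np bdd)) => e e0.
  have e20 : (0 < e / 2)%R by rewrite divr_gt0.
  have [c /bc bce] := Fc _ e20; exists (set_val c);
    first by have [] := set_valP c.
  by rewrite (le_lt_trans bce) // ltr_pdivrMr // ltr_pMr // ltr1n.
have Lb : L b by split=> //; exists y.
exists (exist _ b (mem_set Lb)) => S /nbhs_ballP[e /= e0 eS].
have e20 : (0 < e / 2)%R by rewrite divr_gt0.
have [c Fce] := Fc _ e20; have bce := bc _ _ Fce.
apply: filterS Fce => d /ball_mdist cd; apply/eS/ball_mdist.
rewrite mdist_sub (le_lt_trans (metric_triangle _ (set_val c) _)) //.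
by rewrite [ltRHS]splitr ler_ltD.
Qed.

Lemma limit_space_approximated :
  exists2 D : set (ultralimit omega X), countable D & approximated_by D L.
Proof.
have [D cD Ds] := spt_ultra_measure_approximated np bdd.
by exists D => //; apply: approximated_by_subset Ds => a [].
Qed.

Lemma limit_space_separable : separable_space L.
Proof.
by have [D cD DL] := limit_space_approximated; exact: approximated_separable DL.
Qed.

Lemma limit_space_ball_algebra : ball_algebra L.
Proof.
have [D cD DL] := limit_space_approximated.
apply: (closed_ball_algebra _ cD DL); apply: complete_closed.
exact: limit_space_complete.
Qed.

Lemma limit_space_borel_image (B : set L) : borel B ->
  ball_algebra (set_val @` B).
Proof.
exact: (borel_image_ball_algebra limit_space_ball_algebra
  limit_space_separable).
Qed.

Lemma limit_space_polish : polish_mms (limit_measure omega P).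
Proof.
split; [exact: limit_space_complete|exact: limit_space_separable| |].
  split=> [|B bB|F bF tF].
  - by rewrite /limit_measure image_set0 (mo_set0 mm).
  - by apply: (mo_ge0 mm); exact: limit_space_borel_image.
  rewrite /limit_measure image_bigcup; case: mm => _ _; apply.
    by move=> n; exact: limit_space_borel_image.
  move=> i j _ _ [_ [[a Fa <-] [b Fb /val_inj ba]]]; apply: tF => //.
  by exists a; split=> //; rewrite -ba.
move=> a r; apply: le_lt_trans (ultra_measure_ball_lty np bdd (set_val a) r).
apply: (mo_le sG mm); last 1 first.
- by move=> _ [b /ball_mdist ab <-]; apply/ball_mdist.
- by apply: limit_space_borel_image; exact: borel_ball.
- exact: ball_algebra_ball.
Qed.

End Threads.

(** * The universal property *)

Section BorelMaps.
Local Open Scope ereal_scope.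
Context {R : realType} {T U : metricType R} {f : T -> U}.

(** Made for the factorizing map, which is 1-Lipschitz on the support of its source and is given a
    constant value elsewhere; with [S] the whole space it also covers the projections. *)
Lemma borel_preimage_lipschitz (S : set T) (c : U) : closed S ->
  (forall x y, S x -> S y -> (mdist (f x) (f y) <= mdist x y)%R) ->
  (forall x, ~ S x -> f x = c) -> forall B, borel B -> borel (f @^-1` B).
Proof.
move=> cS lip fc B bB; have sT := @borel_sigma_algebra R T.
have bS := borel_closed cS.
suff bSf : borel (S `&` f @^-1` B).
  have [Bc|nBc] := pselect (B c).
    rewrite (_ : f @^-1` B = (S `&` f @^-1` B) `|` ~` S).
      by apply: (sig_setU sT) => //; exact: (sig_setC sT).
    apply/seteqP; split=> x; last by move=> [[]//|/fc fx];
      rewrite /preimage /= fx.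
    by move=> Bx; have [Sx|] := pselect (S x); [left|right].
  rewrite (_ : f @^-1` B = S `&` f @^-1` B) //.
  apply/seteqP; split=> x; last by case.
  move=> Bx; split=> //; apply: contrapT => /fc fx.
  by apply: nBc; rewrite -fx.
pose G := [set B | borel (S `&` f @^-1` B)].
suff : @borel U `<=` G by apply.
apply: smallest_sub; last first.
  move=> V oV; rewrite /G /=.
  (* A union of balls about points [y] of [S], each of a radius [r] for which the ball about [f y]
     lies in [V]. As [f] does not increase distances on [S], the trace of [W] on [S] is that of the
     preimage of [V]. *)
  pose W := [set x | exists y, [/\ S y, V (f y) &
    exists2 r : R, ball (f y) r `<=` V & (mdist y x < r)%R]].
  have oW : open W.
    apply/open_mdistP => x [y [Sy Vy [r rV yx]]].
    exists (r - mdist y x)%R; first by rewrite subr_gt0.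
    move=> z /ball_mdist xz; exists y; split=> //; exists r => //.
    by rewrite (le_lt_trans (metric_triangle _ x _)) // -ltrBrDl.
  rewrite (_ : _ `&` _ = S `&` W); first by apply: (sig_setI sT) => //;
    exact: borel_open.
  apply/seteqP; split=> x [Sx Vx]; split=> //.
    have [r r0 rV] := (open_mdistP V).1 oV _ Vx.
    by exists x; split=> //; exists r => //; rewrite mdistxx.
  have [y [Sy Vy [r rV yx]]] := Vx.
  by apply/rV/ball_mdist; exact: le_lt_trans (lip _ _ Sy Sx) yx.
split=> [|A GA|F GF].
- by rewrite /G /= preimage_set0 setI0; exact: (sig_set0 sT).
- rewrite /G /= (_ : _ `&` _ = S `\` (S `&` f @^-1` A));
    first exact: (sig_setD sT).
  apply/seteqP; split=> x [Sx].
    by move=> [_ nA]; split=> // -[].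
  by move=> nA; split=> //; split=> // Ax; apply: nA.
- by rewrite /G /= preimage_bigcup setI_bigcupr; exact: (sig_bigcupT sT).
Qed.

Lemma measure_on_pushforward (m : set T -> \bar R) :
  measure_on (@borel T) m -> (forall B, borel B -> borel (f @^-1` B)) ->
  measure_on (@borel U) (fun B => m (f @^-1` B)).
Proof.
move=> mm bf; split=> [|B bB|F bF tF].
- by rewrite preimage_set0 (mo_set0 mm).
- by apply: (mo_ge0 mm); exact: bf.
rewrite preimage_bigcup; case: mm => _ _; apply; first by move=> n; exact: bf.
by move=> i j _ _ [x [xi xj]]; apply: tF => //; exists (f x).
Qed.

End BorelMaps.

Lemma closed_image_set_val (R : realType) (T : metricType R) (A : set T) (D :
  set A) :
  closed A -> closed D -> closed (set_val @` D).
Proof.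
move=> cA cD; apply/closed_mdistP => x h.
have Ax : A x.
  apply: ((closed_mdistP A).1 cA) => e e0; have [_ [a _ <-] xa] := h e e0.
  by exists (set_val a) => //; exact: set_valP.
exists (exist _ x (mem_set Ax)) => //; apply: ((closed_mdistP D).1 cD) => e e0.
by have [_ [a Da <-] xa] := h e e0; exists a.
Qed.

Lemma separable_subset_approximated (R : realType) (T : metricType R) (A :
  set T) :
  separable_space T -> exists D, [/\ countable D, D `<=` A & approximated_by D
    A].
Proof.
move=> /separable_approximated[D cD DT].
have sA : separable_space A.
  by apply: (approximated_separable cD); exact: approximated_by_subset DT.
have [D' cD' D'A] := separable_approximated sA; exists (set_val @` D'); split.
- by apply: (sub_countable (card_image_le _ _)).
- by move=> _ [a _ <-]; exact: set_valP.
- move=> x e Ax e0; have [a D'a ax] := D'A (exist _ x (mem_set Ax)) e Logic.I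
    e0.
  by exists (set_val a) => //; exists a.
Qed.

(** * Projections, factorization and the base point *)

Section Universal.
Local Open Scope ereal_scope.
Context {R : realType} {omega : set_system nat} {UF : UltraFilter omega}.
Context {X : nat -> pmms R} {P : forall i j, X j -> X i}.
Hypotheses (np : nonprincipal omega) (sysP : inverse_system P).

Local Notation base := (fun i => pmms_point (X i)).
Local Notation pb r := (fun i => ball (pmms_point (X i)) r : set (X i)).
Local Notation m i := (pmms_measure (X i)).
Local Notation L := (limit_space omega P).
Local Notation mu := (ultra_measure omega X).
Local Notation proj := (limit_proj omega P).
Local Notation im := (internal_measure omega).
Local Notation int := (internal omega).

Let bdd r := @internal_measure_ball_lty R omega UF X r (inverse_system_bounded
  sysP r).
Let sB (T : metricType R) := @borel_sigma_algebra R T.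
Let polL := limit_space_polish np sysP.

Lemma limit_measure_on : measure_on (@borel L) (limit_measure omega P).
Proof. by have [] := polL. Qed.

Lemma limit_measure_ball_lty (a : L) (r : R) : limit_measure omega P (ball a r)
  < +oo.
Proof. by have [_ _ _] := polL; apply. Qed.

Lemma limit_proj_borel i (B : set (X i)) : borel B -> borel (proj i @^-1` B).
Proof.
apply: (@borel_preimage_lipschitz _ _ _ _ setT (pmms_point (X i))) =>
  [|a b _ _|a []//].
  exact: closedT.
exact: limit_proj_lip.
Qed.

Lemma limit_proj_measure_le i (B : set (X i)) : borel B ->
  limit_measure omega P (proj i @^-1` B) <= m i B.
Proof.
apply: (borel_le_open (mu := fun B => limit_measure omega P (proj i @^-1` B))).
- by apply: measure_on_pushforward; [exact: limit_measure_on|exact: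
    limit_proj_borel].
- exact: pmms_measure_on.
- exact: pmms_ball_lty.
move=> U oU; have bU := borel_open oU.
(* A family close to a thread may leave the supports, where [P i j] is not controlled; the
   complement of the support, being null, absorbs it at no cost. The value at [j < i] is arbitrary,
   as [omega] does not see finitely many indices. *)
pose A : set_family X := fun j =>
  if (i <= j)%N then (@P i j @^-1` U) `|` ~` spt (m j) else set0.
have bA : ball_family A.
  apply/ball_familyP => j; rewrite /A; case: ifPn => ij;
    last exact: sig_set0 (sB _).
  apply: (sig_setU (sB _)).
    by have [bP _ _ _] := inverse_system_morphism sysP ij; exact: bP.
  apply: (sig_setC (sB _)); by apply: borel_closed; exact: pmms_spt_closed.
apply: (@le_trans _ _ (im A)).
  apply: (ultra_measure_le np bdd) => //.
    by apply: (limit_space_borel_image np sysP); exact: limit_proj_borel.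
  move=> u [a Ua aE].
  have [aa ta] := limit_projP a.
  have [r r0 rU] := (open_mdistP U).1 oU _ Ua.
  have : (mdist (set_val a) (ultra_proj u) < r)%R by rewrite aE mdistxx.
  move=> /(represents_lt aa (ultra_proj_represents u)); rewrite /internal /=.
  apply: filterS2 (@ultra_cofinite _ UF np i) => j ij au.
  rewrite /A ij; have [su|] := pselect (spt (m j) (repr (val u) j));
    last by right.
  left; apply/rU/ball_mdist; rewrite -(limit_proj_compat a ij).
  have [_ _ lip _] := inverse_system_morphism sysP ij.
  by apply: le_lt_trans au; apply: lip => //; exact: limit_proj_spt.
apply: internal_measure_le => // r.
rewrite -(ultra_lim_cst (omega := omega) (m i U)); apply: ultra_lim_le.
- exact: measure_ballI_ge0.
- by move=> _; exact: (mo_ge0 (pmms_measure_on _)).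
apply: filterS (@ultra_cofinite _ UF np i) => j ij.
apply: (morphism_measure_le (inverse_system_morphism sysP ij)) => //.
  exact: ball_family_ballI.
by move=> x sx []; rewrite /A ij => -[].
Qed.

Lemma limit_proj_inj (a b : L) : (forall i, proj i a = proj i b) -> a = b.
Proof.
move=> ab; have [aa ta] := limit_projP a; have [bb tb] := limit_projP b.
apply: mdist_positivity; apply/le_anti; rewrite mdist_ge0 andbT mdist_sub.
apply: (represents_le aa bb); apply: nearW => i.
by rewrite ab mdistxx.
Qed.

(** Confinement to one ball prevents mass from escaping to infinity along the coordinates, where the
    truncations in [internal_measure] would lose it. *)
Lemma internal_measure_ge (A : set_family X) (r : R) (c : \bar R) : 0 <= c ->
  ball_family A -> (forall i, A i `<=` pb r i) -> (forall i, c <= m i (A i)) ->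
  c <= im A.
Proof.
move=> c0 bA Ar cA; apply: le_trans (vol_ball_le_measure r bA).
rewrite -{1}(ultra_lim_cst (omega := omega) c); apply: ultra_lim_le => //.
  exact: measure_ballI_ge0.
by apply: nearW => i; rewrite setIidl.
Qed.

Section Factorization.
Context {Y : pmms R} {Q : forall i, Y -> X i}.
Hypothesis projQ : projects_on P Q.

Local Notation mY := (pmms_measure Y).

Let mQ i : morphism (Q i) := projQ.1 i.

Lemma projects_lip i x y : spt mY x -> spt mY y -> (mdist (Q i x) (Q i y) <=
  mdist x y)%R.
Proof. by have [_ _ lip _] := mQ i; exact: lip. Qed.

Lemma projects_point i : Q i (pmms_point Y) = pmms_point (X i).
Proof. by have [_ ->] := mQ i. Qed.

Lemma projects_dist_point i y : spt mY y ->
  (mdist (pmms_point (X i)) (Q i y) <= mdist (pmms_point Y) y)%R.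
Proof. by move=> sy; rewrite -projects_point projects_lip //;
  exact: pmms_point_spt. Qed.

Lemma projects_thread y : spt mY y -> thread P (Q^~ y).
Proof.
move=> sy; split=> [i|i j ij]; first exact: (morphism_spt (mQ i)).
by rewrite [RHS](projQ.2 i j ij).
Qed.

(** The point lies in the support because the ball about each [Q i y] carries at least the mass of
    the ball of the same radius about [y], a positive bound uniform in [i]. The radius is halved to
    pass from an internal ball to the preimage of an open ball. *)
Lemma projects_represents y : spt mY y ->
  exists a : L, represents (set_val a) (Q^~ y).
Proof.
move=> sy; have [|a ay] := @represents_ex _ omega UF X (Q^~ y).
  apply: (le_lt_trans _ (ltry (mdist (pmms_point Y) y)));
    apply: fdist_le_of_all => i.
  by rewrite metric_sym projects_dist_point.
suff La : L a by exists (exist _ a (mem_set La)).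
split; first by exists (Q^~ y) => //; exact: projects_thread.
move=> r r0; have r20 : (0 < r / 2)%R by rewrite divr_gt0.
apply: (lt_le_trans (sy _ r20)).
apply: (@le_trans _ _ (im (fun i => ball (Q i y) (r / 2)))).
  apply: (@internal_measure_ge _ (mdist (pmms_point Y) y + r / 2)).
  - exact/ltW/sy.
  - by move=> i; exact: ball_algebra_ball.
  - by move=> i; apply: ball_sub_ball; rewrite lerD2r projects_dist_point.
  - by move=> i; exact: (morphism_ball_le (mQ i)).
apply: (ultra_measure_ge np bdd).
- exact: ball_algebra_ball.
- by move=> i; exact: ball_algebra_ball.
- by apply: internal_sub_proj_ball => //;
    rewrite ltr_pdivrMr // ltr_pMr // ltr1n.
Qed.

Context {Phi : Y -> L}.
Hypothesis repPhi : forall y, spt mY y -> represents (set_val (Phi y)) (Q^~ y).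
Hypothesis Phi_borel : forall B, borel B -> borel (Phi @^-1` B).

(* Up to [delta], the bounded part [Cr] of [Phi @^-1` D] is covered for every
   [l] by finitely many balls of radius [1 / (l + 1)] centred at points of
   [Phi @^-1` D].  The balls of the same radii centred at the images of these
   points under [Q i] form internal sets of at least the same measure, and a
   point of the ultralimit lying in all of them is in the closure of [D]. *)
Lemma factor_closed_ball_le (D : set L) (r delta : R) : closed D ->
  (0 < delta)%R ->
  mY (Phi @^-1` D `&` spt mY `&` ball (pmms_point Y) r) <=
  limit_measure omega P D + delta%:E.
Proof.
move=> cD d0; set C := Phi @^-1` D `&` spt mY; set Cr := C `&` _.
have mmY := pmms_measure_on Y.
have bC : borel C.
  apply: (sig_setI (sB _)); first by apply: Phi_borel; exact: borel_closed.
  by apply: borel_closed; exact: pmms_spt_closed.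
have bCr : borel Cr by apply: (sig_setI (sB _)) => //; exact: borel_ball.
have bD := limit_space_borel_image np sysP (borel_closed cD).
have mD0 : 0 <= limit_measure omega P D.
  by apply: (mo_ge0 limit_measure_on); exact: borel_closed.
have Croo : mY Cr < +oo.
  apply: le_lt_trans (pmms_ball_lty (pmms_point Y) r).
  by apply: (mo_le (sB _) mmY) => // [|x []//]; exact: borel_ball.
have [E [cE EC EapC]] := separable_subset_approximated C (pmms_separable Y).
have [E0|[y]] := pfcard_geP cE.
  have -> : Cr = set0.
    rewrite -subset0 => x [Cx _]; have [d] := EapC x 1%R Cx ltr01.
    by rewrite E0.
  by rewrite (mo_set0 mmY) adde_ge0 // lee_fin ltW.
have yC k : C (y k) by apply: EC; exact: (@funS _ _ _ _ y).
pose b l k := ball (y k : Y) l.+1%:R^-1.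
have bb l k : borel (b l k) by exact: borel_ball.
have bV l N : borel (\bigcup_(k < N.+1) b l k).
  by rewrite bigcup_mkord; exact: (sig_bigsetU (sB _)).
(* The centres [y k] are dense in [C], so finitely many balls of the [l]-th radius miss mass less
   than [delta / 2 ^ (l + 1)] of [Cr]; the losses over all [l] add up to at most [delta]. *)
have /choice[N NP] l : exists N : nat,
    mY (Cr `\` \bigcup_(k < N.+1) b l k) < (delta / (2 ^ l.+1)%:R)%:E.
  apply: contrapT => /forallNP h.
  have : (delta / (2 ^ l.+1)%:R)%:E <= mY (\bigcap_N (Cr `\` \bigcup_(k < N.+1)
    b l k)).
    apply: (mo_nonincreasing_ge (sB _) mmY) => [N|N k Nk||N].
    - exact: (sig_setD (sB _)).
    - apply/subsetPset; apply: setDS; apply: bigcup_subset => j /= jN.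
      exact: leq_trans jN _.
    - apply: le_lt_trans Croo; apply: (mo_le (sB _) mmY) => //.
      exact: (sig_setD (sB _)).
    - by rewrite leNgt; apply/negP/h.
  rewrite (_ : \bigcap_N _ = set0) ?(mo_set0 mmY).
    by rewrite lee_fin leNgt divr_gt0 // ltr0n expn_gt0.
  rewrite -subset0 => x h'; have [Cx _] := h' 0%N Logic.I.
  have [d + dx] := EapC x l.+1%:R^-1%R Cx.1 (ltac:(by rewrite invr_gt0 ltr0Sn)).
  rewrite -{1}(image_eq y) => -[k _ yd]; have [_] := h' k Logic.I; apply.
  by exists k => //=; apply/ball_mdist; rewrite yd.
pose V l := \bigcup_(k < (N l).+1) b l k.
pose K := Cr `&` \bigcap_l V l.
have bK : borel K.
  by apply: (sig_setI (sB _)) => //; apply: (sig_bigcapT (sB _)) => l;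
    exact: bV.
have CK : mY Cr <= mY K + delta%:E.
  have bDV l : borel (Cr `\` V l) by apply: (sig_setD (sB _)) => //; exact: bV.
  have bDVs : borel (\bigcup_l (Cr `\` V l)) by exact: (sig_bigcupT (sB _)).
  apply: (@le_trans _ _ (mY (K `|` \bigcup_l (Cr `\` V l)))).
    apply: (mo_le (sB _) mmY) => //; first exact: (sig_setU (sB _)).
    move=> x Cx; have [Vx|/existsNP[l nVl]] := pselect (forall l, V l x).
      by left; split=> // l _.
    by right; exists l.
  apply: (le_trans (mo_setU_le (sB _) mmY bK bDVs)); rewrite leeD2l //.
  apply: (le_trans (mo_bigcup_le (sB _) mmY bDV)).
  apply: le_trans (@epsilon_trick0 R delta xpredT (ltW d0)).
  apply: lee_nneseries => [l _ _|l _]; first exact: (mo_ge0 mmY).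
  exact/ltW/NP.
apply: (le_trans CK); rewrite leeD2r //.
pose B l k : set_family X := fun i => ball (Q i (y k)) l.+1%:R^-1.
have bB l k : ball_family (B l k) by move=> i; exact: ball_algebra_ball.
(* Starting from the ball of radius [r] keeps every term in it, and places scale [l] in [A l.+1].
   The intersections are cumulative, so the sequence decreases while each coordinate still receives
   the image under [Q i] of the part of [K] in the support. *)
pose A := fix A n : set_family X :=
  if n is n'.+1 then fun i => A n' i `&` partial_union (B n') (N n') i else pb
    r.
have bA n : ball_family (A n).
  elim: n => [|n ih] /=; first exact: ball_family_ball.
  by apply: ball_familyI => //; exact: ball_family_partial_union.
have Ar n i : A n i `<=` pb r i by elim: n => [|n ih] //= x [/ih].
apply: (ultra_measure_bigcap_ge (A := A) (r := r) np bdd) => // [n i x []//|n|].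
  apply: (@internal_measure_ge _ r) => //; first exact: (mo_ge0 mmY).
  move=> i; apply: (morphism_measure_le (mQ i)) => //;
    first exact: ((ball_familyP (A n)).1 (bA n)).
  move=> x sx [[_ /ball_mdist xr] Vx]; elim: n => [|n ih] /=.
    by apply/ball_mdist; exact: le_lt_trans (projects_dist_point i sx) xr.
  split=> //; have [k kN /ball_mdist xk] := Vx n Logic.I.
  have -> : partial_union (B n) (N n) i = \bigcup_(k < (N n).+1) B n k i.
    by rewrite bigcup_mkord.
  exists k => //; apply/ball_mdist.
  by apply: le_lt_trans xk; apply: projects_lip => //; exact: (yC k).2.
move=> u Au; have cL : closed L by apply: complete_closed;
  exact: limit_space_complete.
apply: ((closed_mdistP _).1 (closed_image_set_val cL cD)) => e e0.
have [l] := ltr_add_invr e0; rewrite add0r => le.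
have : int (partial_union (B l) (N l)) u.
  by have /= := Au l.+1 Logic.I; rewrite internalI => -[].
(* Here the finiteness of the covers matters: one and the same centre [y k] is close to [u] for
   [omega]-a.e. coordinate. *)
rewrite internal_partial_union => -[k _ uk]; exists (set_val (Phi (y k))).
  by exists (Phi (y k)) => //; exact: (yC k).1.
apply: le_lt_trans le; rewrite metric_sym.
apply: (represents_le (repPhi (yC k).2) (ultra_proj_represents u)).
by apply: filterS uk => i /ball_mdist /ltW.
Qed.

Lemma factor_closed_le (D : set L) : closed D ->
  mY (Phi @^-1` D) <= limit_measure omega P D.
Proof.
move=> cD; have mmY := pmms_measure_on Y.
pose F (n : nat) := Phi @^-1` D `&` spt mY `&` ball (pmms_point Y) n%:R.
have bP := Phi_borel (borel_closed cD).
have bs : borel (spt mY) by apply: borel_closed; exact: pmms_spt_closed.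
have bF n : borel (F n).
  by apply: (sig_setI (sB _)); [exact: (sig_setI (sB _))|exact: borel_ball].
have ndF : nondecreasing_seq F.
  move=> n k nk; apply/subsetPset => x [? xn]; split=> //; apply: le_ball xn.
  by rewrite ler_nat.
apply: (@le_trans _ _ (mY (\bigcup_n F n))).
  apply: pmms_measure_le => //; first exact: (sig_bigcupT (sB _)).
  move=> x Dx; exists (Num.truncn (mdist (pmms_point Y) x)).+1 => //.
  by split=> //; apply/ball_mdist; exact: truncnS_gt.
rewrite (mo_nondecreasing_sup (sB _) mmY) //;
  apply: ge_ereal_sup => _ [n _ <-] /=.
by apply/lee_addgt0Pr => e e0; exact: factor_closed_ball_le.
Qed.

(** Open sets are increasing unions of closed ones, and Borel sets follow by outer regularity,
    because [limit_measure] is finite on balls. *)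
Lemma factor_measure_le (B : set L) : borel B ->
  mY (Phi @^-1` B) <= limit_measure omega P B.
Proof.
have mmY := pmms_measure_on Y; have mmP := measure_on_pushforward mmY Phi_borel.
apply: (borel_le_open mmP limit_measure_on limit_measure_ball_lty) => U oU.
have [F [cF ndF UF']] := open_bigcup_closed oU.
have bF n : borel (F n) by exact: borel_closed.
rewrite UF' (mo_nondecreasing_sup (sB _) mmP) //.
apply: ge_ereal_sup => _ [n _ <-] /=; apply: (le_trans (factor_closed_le (cF
  n))).
apply: (mo_le (sB _) limit_measure_on) => //; first exact: (sig_bigcupT (sB _)).
exact: bigcup_sup.
Qed.

End Factorization.

(* No assumption on the base point is made here: it is what shows that the
   existence of an inverse limit forces the base point into the support. *)
Lemma projects_on_factor (Y : pmms R) (Q : forall i, Y -> X i) :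
  projects_on P Q ->
  exists Phi : Y -> L,
    [/\ forall B, borel B -> borel (Phi @^-1` B),
        forall x y, spt (pmms_measure Y) x -> spt (pmms_measure Y) y ->
          (mdist (Phi x) (Phi y) <= mdist x y)%R,
        forall B, borel B -> pmms_measure Y (Phi @^-1` B) <= limit_measure
          omega P B,
        forall i y, spt (pmms_measure Y) y -> proj i (Phi y) = Q i y &
        set_val (Phi (pmms_point Y)) = ultra_point omega X].
Proof.
move=> projQ; have [a0 a0p] := projects_represents projQ (pmms_point_spt Y).
(* The value [a0] off the support only has to be constant, so that [borel_preimage_lipschitz]
   applies; the base point of [Y] shows that [L] has a point to offer. *)
have /choice[Phi PhiP] y : exists a : L,
    (spt (pmms_measure Y) y -> represents (set_val a) (Q^~ y)) /\
    (~ spt (pmms_measure Y) y -> a = a0).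
  have [sy|nsy] := pselect (spt (pmms_measure Y) y); last by exists a0.
  by have [a ay] := projects_represents projQ sy; exists a.
have repPhi y : spt (pmms_measure Y) y -> represents (set_val (Phi y)) (Q^~ y).
  by have [] := PhiP y.
have lip x y : spt (pmms_measure Y) x -> spt (pmms_measure Y) y ->
    (mdist (Phi x) (Phi y) <= mdist x y)%R.
  move=> sx sy; rewrite mdist_sub; apply: (represents_le (repPhi _ sx) (repPhi
    _ sy)).
  by apply: nearW => i; exact: (projects_lip projQ).
have bPhi B : borel B -> borel (Phi @^-1` B).
  apply: (borel_preimage_lipschitz (c := a0) (@pmms_spt_closed _ Y) lip) => x.
  by have [] := PhiP x.
exists Phi; split=> //.
- exact: (factor_measure_le projQ repPhi bPhi).
- move=> i y sy; apply: (limit_proj_eq np sysP (repPhi y sy)).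
  exact: projects_thread.
- have := repPhi _ (pmms_point_spt Y).
  rewrite (_ : Q^~ _ = base); last first.
    by apply: functional_extensionality_dep => i; exact: projects_point.
  move=> rp; apply: mdist_positivity; apply/le_anti; rewrite mdist_ge0 andbT.
  apply: (represents_le rp represents_point); apply: nearW => i.
  by rewrite mdistxx.
Qed.

(** Up to a null set, the factor map sends a ball about the base point of [Y] into the ball of the
    same radius about its image, and the domination of measures passes the positive mass on. *)
Lemma projects_on_point_spt (Y : pmms R) (Q : forall i, Y -> X i) :
  projects_on P Q ->
  exists2 pX : L, set_val pX = ultra_point omega X & spt (limit_measure omega
    P) pX.
Proof.
move=> /projects_on_factor[Phi [bPhi lip mPhi _ Phip]].
exists (Phi (pmms_point Y)) => // r r0; apply: (lt_le_trans (pmms_point_spt Y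
  r0)).
apply: le_trans (mPhi _ _); last exact: borel_ball.
apply: pmms_measure_le; [exact: borel_ball|by apply: bPhi; exact: borel_ball|].
move=> x [/ball_mdist xr sx]; apply/ball_mdist; apply: le_lt_trans xr.
by apply: lip => //; exact: pmms_point_spt.
Qed.

Lemma limit_space_inverse_limit (polX : polish_mms (limit_measure omega P)) (pX
  : L)
    (pX_spt : spt (limit_measure omega P) pX) : set_val pX = ultra_point omega
      X ->
  inverse_limit P (L := Pmms polX pX_spt) (limit_proj omega P).
Proof.
move=> pXE; split.
  split=> [i|i j ij a _]; last by rewrite /= limit_proj_compat.
  split=> [B bB||a b _ _|B bB].
  - exact: limit_proj_borel.
  (* The base points themselves form a thread, since they lie in the supports and are preserved by
     the maps [P i j]; uniqueness of threads then gives the projections of [pX]. *)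
  - have rp : represents (set_val pX) base by rewrite pXE;
      exact: represents_point.
    apply: (limit_proj_eq np sysP rp).
    split=> [j|j k jk]; first exact: pmms_point_spt.
    by have [] := inverse_system_morphism sysP jk.
  - exact: limit_proj_lip.
  - exact: limit_proj_measure_le.
move=> Y Q projQ; have [Phi [bPhi lip mPhi PhiQ Phip]] := projects_on_factor
  projQ.
exists Phi; split.
- by split=> //=; apply: val_inj; exact: etrans Phip (esym pXE).
- by move=> i y sy /=; rewrite PhiQ.
- move=> Psi mPsi PsiQ y sy; apply: limit_proj_inj => i.
  by rewrite PhiQ // (PsiQ i y sy).
Qed.

End Universal.

Unset Implicit Arguments.

Theorem theorem15p1 (R : realType) (omega : set_system nat)
    (UF : UltraFilter omega) (X : nat -> pmms R) (P : forall i j, X j -> X i) :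
  nonprincipal omega ->
  inverse_system P ->
  [/\ uniformly_boundedly_finite X,
      ultralimit_exists omega X,
      forall A : set (limit_space omega P),
        borel A -> ball_algebra (set_val @` A) &
      exists polX : polish_mms (limit_measure omega P),
        ((exists (L : pmms R) (p : forall i, L -> X i), inverse_limit P p) <->
         (exists2 pX : limit_space omega P, set_val pX = ultra_point omega X &
            spt (limit_measure omega P) pX)) /\
        (forall (pX : limit_space omega P)
           (pX_spt : spt (limit_measure omega P) pX),
           set_val pX = ultra_point omega X ->
           inverse_limit P (L := Pmms polX pX_spt) (limit_proj omega P))].
Proof.
move=> np sysP; split.
- exact: (inverse_system_ubf sysP).
- apply: ultralimit_existsP => // r.
  by apply: internal_measure_ball_lty; exact: (inverse_system_bounded sysP).
- exact: (limit_space_borel_image np sysP).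
exists (limit_space_polish np sysP); split; last exact: limit_space_inverse_limit.
split=> [[L [p [projp _]]]|[pX pXE pX_spt]]; first exact: projects_on_point_spt projp.
exists (Pmms (limit_space_polish np sysP) pX_spt), (limit_proj omega P).
exact: limit_space_inverse_limit.
Qed.
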